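(* Let $\mathfrak{L}$ be a non-zero semi-simple left Leibniz algebra over a field $\mathbb{F}$ of characteristic zero whose canonical Lie algebra $\mathfrak{L}_{\mathrm{Lie}}$ is finite dimensional. Then the Grothendieck ring $\mathrm{Gr}^{\mathrm{bi}}(\mathfrak{L})$ is neither alternative nor a Jordan ring.
   Context: Rings are not assumed associative. A ring is alternative if $u^2v=u(uv)$ and $(vu)u=vu^2$ for all elements $u,v$; a commutative ring is a Jordan ring if $(u^2v)u=u^2(vu)$ for all $u,v$. A left Leibniz algebra is an $\mathbb{F}$-vector space $\mathfrak{L}$ with a bilinear multiplication satisfying $x(yz)=(xy)z+y(xz)$. Its canonical Lie algebra is $\mathfrak{L}_{\mathrm{Lie}}:=\mathfrak{L}/\mathrm{Leib}(\mathfrak{L})$, where $\mathrm{Leib}(\mathfrak{L}):=\langle x^2\mid x\in\mathfrak{L}\rangle_{\mathbb{F}}$ (an ideal). $\mathfrak{L}$ is semi-simple if $\mathrm{Leib}(\mathfrak{L})$ contains every solvable ideal of $\mathfrak{L}$; in this case $\mathfrak{L}_{\mathrm{Lie}}$ is a semi-simple Lie algebra. An $\mathfrak{L}$-bimodule is an $\mathbb{F}$-vector space $M$ with bilinear left and right $\mathfrak{L}$-actions satisfying, for all $x,y\in\mathfrak{L}$, $m\in M$: (LLM) $(xy)\cdot m=x\cdot(y\cdot m)-y\cdot(x\cdot m)$; (LML) $(x\cdot m)\cdot y=x\cdot(m\cdot y)-m\cdot(xy)$; (MLL) $(m\cdot x)\cdot y=m\cdot(xy)-x\cdot(m\cdot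 y)$. For $\mathfrak{L}$-bimodules $M,N$, the space $M\otimes N$ (over $\mathbb{F}$) carries the actions $x\cdot(m\otimes n):=(x\cdot m)\otimes n+m\otimes(x\cdot n)$ and $(m\otimes n)\cdot x:=(m\cdot x)\otimes n+m\otimes(n\cdot x)$. Let $T(M,N)$ be the smallest subspace of $M\otimes N$ closed under both actions and containing all elements $(x\cdot m+m\cdot x)\otimes(n\cdot y)+(m\cdot y)\otimes(x\cdot n+n\cdot x)$ with $x,y\in\mathfrak{L}$, $m\in M$, $n\in N$. The truncated tensor product $M\,\overline{\otimes}\,N:=(M\otimes N)/T(M,N)$ is an $\mathfrak{L}$-bimodule. $\mathrm{Gr}^{\mathrm{bi}}(\mathfrak{L})$ is the free abelian group on the set $\mathrm{Irr}^{\mathrm{bi}}(\mathfrak{L})$ of isomorphism classes of finite-dimensional irreducible $\mathfrak{L}$-bimodules; each finite-dimensional $\mathfrak{L}$-bimodule $X$ has a class $[X]:=\sum_{[L]}[X:L][L]$, where $[X:L]$ is the composition multiplicity. Its multiplication is the biadditive extension of $[M]\cdot[N]:=[M\,\overline{\otimes}\,N]$ for $[M],[N]\in\mathrm{Irr}^{\mathrm{bi}}(\mathfrak{L})$; it is commutative. *)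

(* Defs.v *)
From HB Require Import structures.
From mathcomp Require Import all_boot all_order all_algebra ring.
From mathcomp Require Import generic_quotient ring_quotient.
From mathcomp Require Import boolp classical_sets fsbigop.
From mathcomp Require Import freeg.

Set Implicit Arguments.
Unset Strict Implicit.
Unset Printing Implicit Defensive.

Import GRing.Theory.

Local Open Scope ring_scope.
Local Open Scope classical_set_scope.
Local Open Scope quotient_scope.

Section Subspaces.
Variables (F : fieldType) (V : lmodType F).

Definition subspace (S : set V) : Prop :=
  S 0 /\ forall (a : F) (u v : V), S u -> S v -> S (a *: u + v).

Definition lspan (A : set V) : set V := smallest subspace A.

Lemma lspan_subspace (A : set V) : subspace (lspan A).
Proof.
split=> [S [[S0 _] _]//|a u v Au Av S SA].
by apply: (SA.1.2); [exact: Au|exact: Av].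
Qed.

Definition finite_dimensional : Prop :=
  exists (n : nat) (e : 'I_n -> V),
    forall v, exists c : 'I_n -> F, v = \sum_i c i *: e i.

End Subspaces.

(* The quotient vector space V / <A>, as an lmodType.                         *)
Section LinearQuotient.
Variables (F : fieldType) (V : lmodType F) (A : set V).

Definition in_lspan : {pred V} := fun v => `[< lspan A v >].

Fact in_lspan_submod : submod_closed in_lspan.
Proof.
have [S0 SD] := lspan_subspace A.
split=> [|a u v /asboolP Su /asboolP Sv]; apply/asboolP => //.
exact: SD.
Qed.

HB.instance Definition _ :=
  GRing.isSubmodClosed.Build F V in_lspan in_lspan_submod.

Definition lquot : Type := Quotient.quot in_lspan.

HB.instance Definition _ := GRing.Zmodule.on lquot.
HB.instance Definition _ := EqQuotient.on lquot.

Definition lquot_scale (a : F) (q : lquot) : lquot := \pi_lquot (a *: repr q).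

Fact pi_lquotD (u v : V) : \pi_lquot (u + v) = \pi_lquot u + \pi_lquot v.
Proof. by rewrite !piE. Qed.

Fact pi_lquot_eq (u v : V) : u - v \in in_lspan -> \pi_lquot u = \pi_lquot v.
Proof. by move=> uv; apply/eqP; rewrite piE /Quotient.equiv. Qed.

Fact pi_lquotZ (a : F) (v : V) : \pi_lquot (a *: v) = lquot_scale a (\pi_lquot v).
Proof.
apply: pi_lquot_eq; rewrite -scalerBr; apply: rpredZ.
have -> := Quotient.idealrBE in_lspan v (repr (\pi_lquot v)).
by apply/eqP; rewrite -[LHS](@reprK _ lquot).
Qed.

Fact lquot_surj (q : lquot) : exists v, q = \pi_lquot v.
Proof. by exists (repr q); rewrite reprK. Qed.

Fact lquot_scaleA a b q : lquot_scale a (lquot_scale b q) = lquot_scale (a * b) q.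
Proof. by have [v ->] := lquot_surj q; rewrite -!pi_lquotZ scalerA. Qed.

Fact lquot_scale1 q : lquot_scale 1 q = q.
Proof. by rewrite /lquot_scale scale1r reprK. Qed.

Fact lquot_scaleDr : right_distributive lquot_scale +%R.
Proof.
move=> a q r; have [v ->] := lquot_surj q; have [w ->] := lquot_surj r.
by rewrite -pi_lquotD -!pi_lquotZ -pi_lquotD scalerDr.
Qed.

Fact lquot_scaleDl q : {morph lquot_scale^~ q : a b / a + b}.
Proof.
move=> a b; have [v ->] := lquot_surj q.
by rewrite -!pi_lquotZ -pi_lquotD scalerDl.
Qed.

HB.instance Definition _ := GRing.Zmodule_isLmodule.Build F lquot
  lquot_scaleA lquot_scale1 lquot_scaleDr lquot_scaleDl.

End LinearQuotient.

Record leibnizAlgebra (F : fieldType) := LeibnizAlgebra {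
  leibniz_sort :> lmodType F;
  lbr : {bilinear leibniz_sort -> leibniz_sort -> leibniz_sort};
  lbr_leibniz : forall x y z : leibniz_sort,
    lbr x (lbr y z) = lbr (lbr x y) z + lbr y (lbr x z)
}.

Section LeibnizTheory.
Variables (F : fieldType) (L : leibnizAlgebra F).
Local Notation "x ** y" := (lbr L x y) (at level 40).

Definition squares : set L := [set x ** x | x in setT].
Definition Leib : set L := lspan squares.

(* The vector space L / Leib(L); its Lie bracket is not needed below.         *)
Definition canonical_Lie : lmodType F := lquot squares.

Definition leibniz_ideal (I : set L) : Prop :=
  subspace I /\ forall x y : L, I y -> I (x ** y) /\ I (y ** x).

Fixpoint derived_series (I : set L) (n : nat) : set L :=
  if n is m.+1 then
    lspan [set x ** y | x in derived_series I m & y in derived_series I m]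
  else I.

Definition solvable_ideal (I : set L) : Prop := exists n, derived_series I n = [set 0].

Definition semisimple : Prop :=
  forall I : set L, leibniz_ideal I -> solvable_ideal I -> I `<=` Leib.

End LeibnizTheory.

(* A pair of bilinear left and right actions of L on V, without axioms:       *)
(* [lact X x m] is x.m and [ract X x m] is m.x. The tensor product of two     *)
(* bimodules is such a pair but in general not a bimodule.                    *)
Record biaction (F : fieldType) (L : leibnizAlgebra F) (V : vectType F) :=
  Biaction {
    lact : {linear L -> 'End(V)};
    ract : {linear L -> 'End(V)}
  }.

Section Biactions.
Variables (F : fieldType) (L : leibnizAlgebra F).
Local Notation "x ** y" := (lbr L x y) (at level 40).

Definition is_bimodule (V : vectType F) (X : biaction L V) : Prop :=
  [/\ forall x y m,
        lact X (x ** y) m = lact X x (lact X y m) - lact X y (lact X x m),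
      forall x y m,
        ract X y (lact X x m) = lact X x (ract X y m) - ract X (x ** y) m
    & forall x y m,
        ract X y (ract X x m) = ract X (x ** y) m - lact X x (ract X y m)].

Definition stable (V : vectType F) (X : biaction L V) (U : {vspace V}) : Prop :=
  forall x m, m \in U -> lact X x m \in U /\ ract X x m \in U.

Definition irreducible (V : vectType F) (X : biaction L V) : Prop :=
  (fullv : {vspace V}) <> 0%VS /\
  forall U : {vspace V}, stable X U -> U = 0%VS \/ U = fullv.

Definition isomorphic (V W : vectType F) (X : biaction L V) (Y : biaction L W) :
    Prop :=
  exists f : 'Hom(V, W), bijective f /\
    forall x m, f (lact X x m) = lact Y x (f m) /\
                f (ract X x m) = ract Y x (f m).

(* Transport of the actions along a retraction p : V -> W of i : W -> V.      *)
Section Transport.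
Variables (V W : vectType F) (i : 'Hom(W, V)) (p : 'Hom(V, W)).

Definition conj_act (a : {linear L -> 'End(V)}) (x : L) : 'End(W) :=
  (p \o a x \o i)%VF.

Fact conj_act_linear a : linear (conj_act a).
Proof.
move=> c x y; apply/lfunP => w.
rewrite /conj_act add_lfunE scale_lfunE !comp_lfunE linearP.
by rewrite add_lfunE scale_lfunE linearP.
Qed.

HB.instance Definition _ a :=
  GRing.isLinear.Build F L 'End(W) *:%R (conj_act a) (conj_act_linear a).

Definition transport (X : biaction L V) : biaction L W :=
  Biaction (conj_act (lact X)) (conj_act (ract X)).
End Transport.

Definition sub_biaction (V : vectType F) (X : biaction L V) (U : {vspace V}) :
    biaction L (subvs_of U) :=
  transport (linfun vsval) (linfun (vsproj U)) X.

(* V / U is realised on the complement U^C; the canonical surjection          *)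
(* V -> V / U is then the projection onto U^C along U.                        *)
Definition quot_proj (V : vectType F) (U : {vspace V}) : 'Hom(V, subvs_of (U^C)) :=
  (linfun (vsproj (U^C)) \o daddv_pi (U^C) U)%VF.

Definition quot_biaction (V : vectType F) (X : biaction L V) (U : {vspace V}) :
    biaction L (subvs_of (U^C)) :=
  transport (linfun vsval) (quot_proj U) X.

Lemma quot_projK (V : vectType F) (U : {vspace V}) :
  cancel (vsval : subvs_of (U^C) -> V) (quot_proj U).
Proof.
move=> w; rewrite /quot_proj !lfun_simp /= daddv_pi_id ?subvsP ?vsvalK //.
by rewrite capvC capv_compl.
Qed.

Lemma lker_quot_proj (V : vectType F) (U : {vspace V}) : lker (quot_proj U) = U.
Proof.
have CU : (U^C :&: U = 0)%VS by rewrite capvC capv_compl.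
apply/vspaceP => v; rewrite memv_ker; apply/eqP/idP => [|Uv].
  rewrite /quot_proj !lfun_simp /= => /(congr1 vsval).
  rewrite vsprojK ?memv_pi // linear0 => pv0.
  have := daddv_pi_add CU (_ : v \in (U^C + U)%VS).
  rewrite addvC addv_complf memvf pv0 add0r => /(_ isT) <-; exact: memv_pi.
rewrite /quot_proj !lfun_simp /=.
have := daddv_pi_add CU (_ : v \in (U^C + U)%VS).
rewrite addvC addv_complf memvf [daddv_pi U _ v]daddv_pi_id ?capv_compl //.
by move=> /(_ isT) /(canRL (addrK v)); rewrite subrr => ->; rewrite linear0.
Qed.

Lemma quot_proj_equivariant (V : vectType F) (X : biaction L V) (U : {vspace V}) :
  stable X U -> forall x m,
    quot_proj U (lact X x m) = lact (quot_biaction X U) x (quot_proj U m) /\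
    quot_proj U (ract X x m) = ract (quot_biaction X U) x (quot_proj U m).
Proof.
move=> sU x m.
have Um : m - vsval (quot_proj U m) \in U.
  suff: m - vsval (quot_proj U m) \in lker (quot_proj U).
    by rewrite lker_quot_proj.
  by rewrite memv_ker linearB /= quot_projK subrr.
have key (a : 'End(V)) : (forall m, m \in U -> a m \in U) ->
    quot_proj U (a m) = quot_proj U (a (vsval (quot_proj U m))).
  move=> /(_ _ Um) aU; apply/eqP; rewrite -subr_eq0 -!linearB /=.
  by rewrite -memv_ker lker_quot_proj.
by split; rewrite key => [|n /(sU x)[]//]; rewrite /= /conj_act !lfun_simp.
Qed.

Lemma quot_bimodule (V : vectType F) (X : biaction L V) (U : {vspace V}) :
  is_bimodule X -> stable X U -> is_bimodule (quot_biaction X U).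
Proof.
move=> [LLM LML MLL] sU; have eq := quot_proj_equivariant sU.
have eql x m := (eq x m).1; have eqr x m := (eq x m).2.
by split=> x y m; rewrite -[m]quot_projK -!(eql, eqr, linearB) ?(LLM, LML, MLL).
Qed.

(* The section W / U for U <= W <= V.                                         *)
Definition section_biaction (V : vectType F) (X : biaction L V)
    (U W : {vspace V}) :=
  quot_biaction (sub_biaction X W) (linfun vsval @^-1: U)%VS.

Definition composition_series (V : vectType F) (X : biaction L V)
    (n : nat) (c : nat -> {vspace V}) : Prop :=
  [/\ c 0%N = 0%VS, c n = fullv &
      forall i, (i < n)%N ->
        [/\ (c i <= c i.+1)%VS, stable X (c i), stable X (c i.+1) &
            irreducible (section_biaction X (c i) (c i.+1))]].

(* [X : Y]: all composition series give the same number of factors, so any    *)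
(* value in the set may be taken.                                             *)
Definition multiplicity (V W : vectType F) (X : biaction L V)
    (Y : biaction L W) : nat :=
  xget 0%N [set k | exists n c, composition_series X n c /\
    k = #|[set i : 'I_n |
            `[< isomorphic (section_biaction X (c i) (c i.+1)) Y >]]%SET| ].

End Biactions.

Section Tensor.
Variables (F : fieldType) (V W : vectType F).
Let e := vbasis (fullv : {vspace V}).
Let e' := vbasis (fullv : {vspace W}).

(* V (x) W is realised by coordinate matrices in fixed bases of V and W;      *)
(* [tens_liftE] and [tens_eq] are its universal property.                     *)
Definition tensor : vectType F :=
  'M[F]_(\dim (fullv : {vspace V}), \dim (fullv : {vspace W})).

Definition tens (v : V) (w : W) : tensor :=
  \matrix_(i, j) (coord e i v * coord e' j w).

(* The linear map on V (x) W that sends v (x) w to b v w, for bilinear b.     *)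
Definition tens_lift (U : lmodType F) (b : V -> W -> U) (t : tensor) : U :=
  \sum_i \sum_j t i j *: b e`_i e'`_j.

Lemma tens_linearl w : linear (tens^~ w).
Proof. by move=> a u v; apply/matrixP => i j; rewrite !mxE linearP mulrDl mulrA. Qed.

Lemma tens_linearr v : linear (tens v).
Proof.
by move=> a u w; apply/matrixP => i j; rewrite !mxE linearP mulrDr mulrCA.
Qed.

Lemma tens_lift_linear (U : lmodType F) (b : V -> W -> U) : linear (tens_lift b).
Proof.
move=> a s t; rewrite /tens_lift scaler_sumr -big_split; apply: eq_bigr => i _.
rewrite scaler_sumr -big_split; apply: eq_bigr => j _ /=.
by rewrite !mxE scalerDl scalerA.
Qed.

HB.instance Definition _ (U : lmodType F) (b : V -> W -> U) :=
  GRing.isLinear.Build F tensor U *:%R (tens_lift b) (tens_lift_linear b).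

Lemma tens_liftE (U : lmodType F) (b : V -> W -> U) :
  (forall w, linear (b^~ w)) -> (forall v, linear (b v)) ->
  forall v w, tens_lift b (tens v w) = b v w.
Proof.
move=> bl br v w.
pose blM w := GRing.isLinear.Build F V U *:%R (b^~ w) (bl w).
pose brM v := GRing.isLinear.Build F W U *:%R (b v) (br v).
pose BL w : {linear V -> U} := HB.pack (b^~ w) (blM w).
pose BR v : {linear W -> U} := HB.pack (b v) (brM v).
have -> : b v w = \sum_i coord e i v *: b e`_i w.
  rewrite -[LHS]/(BL w v) {1}(coord_vbasis (memvf v)) linear_sum.
  by apply: eq_bigr => i _; rewrite linearZ.
apply: eq_bigr => i _.
have -> : b e`_i w = \sum_j coord e' j w *: b e`_i e'`_j.
  rewrite -[LHS]/(BR e`_i w) {1}(coord_vbasis (memvf w)) linear_sum.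
  by apply: eq_bigr => j _; rewrite linearZ.
by rewrite scaler_sumr; apply: eq_bigr => j _; rewrite mxE scalerA.
Qed.

Lemma tens_eq (U : lmodType F) (f g : {linear tensor -> U}) :
  (forall v w, f (tens v w) = g (tens v w)) -> f =1 g.
Proof.
have dE i j : delta_mx i j = tens e`_i e'`_j.
  apply/matrixP => k l; rewrite !mxE !coord_free ?(basis_free (vbasisP _)) //.
  by rewrite -natrM mulnb [k == i]eq_sym [l == j]eq_sym.
move=> fg t; rewrite [t]matrix_sum_delta !linear_sum; apply: eq_bigr => i _.
by rewrite !linear_sum; apply: eq_bigr => j _; rewrite !linearZ /= dE fg.
Qed.

End Tensor.

Section TruncatedTensor.
Variables (F : fieldType) (L : leibnizAlgebra F).

Section TensorAction.
Variables (V W : vectType F).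

(* x |-> (v (x) w |-> (a x v) (x) w + v (x) (b x w))                          *)
Definition tens_act (a : {linear L -> 'End(V)}) (b : {linear L -> 'End(W)})
    (x : L) : 'End(tensor V W) :=
  linfun (tens_lift (fun v w => tens (a x v) w + tens v (b x w))).

Lemma tens_actE a b x v w :
  tens_act a b x (tens v w) = tens (a x v) w + tens v (b x w).
Proof.
rewrite lfunE /= tens_liftE // => [w'|v'] c u1 u2.
  by rewrite linearP !tens_linearl scalerDr addrACA.
by rewrite linearP !tens_linearr scalerDr addrACA.
Qed.

Fact tens_act_linear a b : linear (tens_act a b).
Proof.
move=> c x y; apply/lfunP; apply: tens_eq => v w.
rewrite /= add_lfunE scale_lfunE !tens_actE !linearP /= !add_lfunE !scale_lfunE.
by rewrite tens_linearl tens_linearr scalerDr addrACA.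
Qed.

HB.instance Definition _ a b := GRing.isLinear.Build F L 'End(tensor V W) *:%R
  (tens_act a b) (tens_act_linear a b).

Definition tensor_biaction (M : biaction L V) (N : biaction L W) :
    biaction L (tensor V W) :=
  Biaction (tens_act (lact M) (lact N)) (tens_act (ract M) (ract N)).

Definition trunc_gens (M : biaction L V) (N : biaction L W) :
    set (tensor V W) :=
  [set t | exists (x y : L) (m : V) (n : W),
    t = tens (lact M x m + ract M x m) (ract N y n)
        + tens (ract M y m) (lact N x n + ract N x n)].

End TensorAction.

Definition is_generated (V : vectType F) (X : biaction L V) (G : set V)
    (U : {vspace V}) : Prop :=
  [/\ stable X U, forall v, G v -> v \in U &
      forall U' : {vspace V}, stable X U' -> (forall v, G v -> v \in U') ->
        (U <= U')%VS].

Definition generated (V : vectType F) (X : biaction L V) (G : set V) :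
    {vspace V} := xget fullv (is_generated X G).

Lemma generatedP (V : vectType F) (X : biaction L V) (G : set V) :
  is_generated X G (generated X G).
Proof.
rewrite /generated; apply: (@xgetPex _ fullv (is_generated X G)).
pose P U := stable X U /\ forall v, G v -> v \in U.
pose Q k := `[< exists2 U, P U & \dim U = k >].
have exQ : exists k, Q k.
  exists (\dim (fullv : {vspace V})); apply/asboolP; exists fullv => //.
  by split=> [x m _|v _]; [split|]; exact: memvf.
case: (ex_minnP exQ) => k /asboolP[U [sU GU] dU] kmin.
exists U; split=> // U' sU' GU'.
have sUU' : stable X (U :&: U').
  move=> x m; rewrite !memv_cap => /andP[/(sU x)[-> ->]].
  by move=> /(sU' x)[-> ->].
have /kmin : Q (\dim (U :&: U')).
  apply/asboolP; exists (U :&: U')%VS => //; split=> // v Gv.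
  by rewrite memv_cap GU ?GU'.
rewrite -dU => dUU'; apply/capv_idPl/eqP.
by rewrite eqEdim capvSl.
Qed.

Section Truncation.
Variables (V W : vectType F) (M : biaction L V) (N : biaction L W).

Definition trunc_sub : {vspace tensor V W} :=
  generated (tensor_biaction M N) (trunc_gens M N).

Definition trunc_tensor : biaction L (subvs_of (trunc_sub^C)) :=
  quot_biaction (tensor_biaction M N) trunc_sub.

Lemma trunc_sub_stable : stable (tensor_biaction M N) trunc_sub.
Proof. by case: (generatedP (tensor_biaction M N) (trunc_gens M N)). Qed.

Lemma trunc_bimodule :
  is_bimodule M -> is_bimodule N -> is_bimodule trunc_tensor.
Proof.
move=> [LLM LML MLL] [LLN LMN MLN].
have [sT TG _] := generatedP (tensor_biaction M N) (trunc_gens M N).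
rewrite /trunc_tensor -/trunc_sub in sT TG *.
set X := tensor_biaction M N in sT TG *.
have eq := quot_proj_equivariant sT.
have eql x t := (eq x t).1; have eqr x t := (eq x t).2.
have ext (U : vectType F) (f g : 'Hom(tensor V W, U)) :
  (forall v w, f (tens v w) = g (tens v w)) -> forall t, f t = g t.
  by move=> fg; apply: tens_eq.
have LLT x y t :
    lact X (lbr L x y) t = lact X x (lact X y t) - lact X y (lact X x t).
  pose g := ((lact X x \o lact X y) - (lact X y \o lact X x))%VF.
  have -> : lact X (lbr L x y) t = g t.
    apply: ext => v w; rewrite /g /= add_lfunE opp_lfunE !comp_lfunE /= !tens_actE.
    rewrite !linearD /= !tens_actE LLM LLN.
    by apply/matrixP => i j; rewrite !mxE !linearB; ring.
  by rewrite /g /= add_lfunE opp_lfunE !comp_lfunE.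
have LMT x y t :
    ract X y (lact X x t) = lact X x (ract X y t) - ract X (lbr L x y) t.
  pose f := (ract X y \o lact X x)%VF.
  pose g := ((lact X x \o ract X y)%VF - ract X (lbr L x y)).
  have : f t = g t.
    apply: ext => v w; rewrite /f /g /= add_lfunE opp_lfunE !comp_lfunE /=.
    rewrite !tens_actE !linearD /= !tens_actE.
    have -> : ract M (lbr L x y) v = lact M x (ract M y v) - ract M y (lact M x v).
      by rewrite LML opprB addrC subrK.
    have -> : ract N (lbr L x y) w = lact N x (ract N y w) - ract N y (lact N x w).
      by rewrite LMN opprB addrC subrK.
    by apply/matrixP => i j; rewrite !mxE !linearB; ring.
  by rewrite /f /g /= add_lfunE opp_lfunE !comp_lfunE.
have MLT x y t : ract X y (lact X x t + ract X x t) \in trunc_sub.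
  pose f := (quot_proj trunc_sub \o (ract X y \o (lact X x + ract X x)))%VF.
  have fE s : f s = quot_proj trunc_sub (ract X y (lact X x s + ract X x s)).
    rewrite [LHS]comp_lfunE; congr (quot_proj _ _).
    by rewrite comp_lfunE add_lfunE.
  suff: f t = 0.
    by rewrite fE => /eqP; rewrite -memv_ker lker_quot_proj.
  rewrite -(zero_lfunE _ t); apply: ext => v w; rewrite zero_lfunE fE; apply/eqP.
  rewrite -memv_ker lker_quot_proj /= !tens_actE.
  have M0 : ract M y (lact M x v) = - ract M y (ract M x v).
    by rewrite LML MLL opprB.
  have N0 : ract N y (lact N x w) = - ract N y (ract N x w).
    by rewrite LMN MLN opprB.
  have := TG _ (ex_intro _ x (ex_intro _ y (ex_intro _ v (ex_intro _ w erefl)))).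
  set r := (X in X \in _ -> _); set l := (X in _ -> X \in _).
  suff -> : l = r by [].
  rewrite /l /r !linearD /= !tens_actE M0 N0.
  by apply/matrixP => i j; rewrite !mxE !linearD !linearN /=; ring.
split=> x y q; rewrite -[q]quot_projK; move: (vsval q) => {q} t.
- rewrite -(eql _ t) -(eql y t) -(eql x t) -(eql x (lact X y t)).
  by rewrite -(eql y (lact X x t)) LLT linearB.
- by rewrite -(eql x t) -(eqr y (lact X x t)) -(eqr y t) -(eqr _ t)
    -(eql x (ract X y t)) LMT linearB.
rewrite -(eqr x t) -(eqr y (ract X x t)) -(eqr y t) -(eqr _ t).
rewrite -(eql x (ract X y t)) -linearB /=; apply/eqP.
rewrite -subr_eq0 -linearB /= -memv_ker lker_quot_proj opprB addrC.
by rewrite -LMT -linearD; exact: MLT.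
Qed.

End Truncation.
End TruncatedTensor.

(* Up to isomorphism every finite-dimensional bimodule lives on some F^n, so  *)
(* isomorphism classes are taken among these.                                 *)
Record irrBimodule (F : fieldType) (L : leibnizAlgebra F) := IrrBimodule {
  irr_dim : nat;
  irr_act :> biaction L 'rV[F]_irr_dim;
  irr_bimodule : is_bimodule irr_act;
  irr_irreducible : irreducible irr_act
}.

Section Grothendieck.
Variables (F : fieldType) (L : leibnizAlgebra F).

Definition irr_iso (X Y : {classic irrBimodule L}) : bool :=
  `[< isomorphic (X : irrBimodule L) (Y : irrBimodule L) >].

Fact irr_iso_refl : reflexive irr_iso.
Proof.
move=> X; apply/asboolP; exists \1%VF; split=> [|x m]; last by rewrite !id_lfunE.
by exists idfun => m; rewrite id_lfunE.
Qed.

Fact irr_iso_sym : symmetric irr_iso.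
Proof.
suff imp X Y : irr_iso X Y -> irr_iso Y X by move=> X Y; apply/idP/idP => /imp.
move=> /asboolP[f [f_bij fE]]; apply/asboolP; exists (f^-1)%VF.
have f0 : lker f == 0%VS by apply/lker0P; exact: bij_inj.
have fV : cancel (f^-1)%VF f.
  by case: f_bij => g fK gK w; rewrite -[w]gK lker0_lfunK.
split; first by exists f => //; exact: lker0_lfunK.
by move=> x m; split; rewrite -{1}[m]fV -?(fE _ _).1 -?(fE _ _).2 lker0_lfunK.
Qed.

Fact irr_iso_trans : transitive irr_iso.
Proof.
move=> Y X Z /asboolP[f [f_bij fE]] /asboolP[g [g_bij gE]].
apply/asboolP; exists (g \o f)%VF; split.
  by apply: (eq_bij (bij_comp g_bij f_bij)) => m; rewrite comp_lfunE.
by move=> x m; rewrite !comp_lfunE (fE _ _).1 (fE _ _).2 (gE _ _).1 (gE _ _).2.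
Qed.

Canonical irr_iso_equiv := EquivRel irr_iso irr_iso_refl irr_iso_sym irr_iso_trans.
Canonical irr_iso_encModRel := defaultEncModRel irr_iso.

Definition Irr : Type := {eq_quot irr_iso}.

HB.instance Definition _ := EqQuotient.on Irr.
HB.instance Definition _ := Choice.on Irr.

Definition irr_repr (a : Irr) : irrBimodule L := repr a.

Definition Gr : Type := {freeg Irr}.

Definition gr_class (V : vectType F) (X : biaction L V) : Gr :=
  \sum_(a \in [set: Irr]) << (multiplicity X (irr_repr a))%:Z *g a >>.

Definition gr_mul (u v : Gr) : Gr :=
  \sum_(a <- dom u) \sum_(b <- dom v)
    gr_class (trunc_tensor (irr_repr a) (irr_repr b)) *~ (coeff a u * coeff b v).

End Grothendieck.

Section NonassociativeRings.
Variables (R : Type) (mul : R -> R -> R).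
Local Notation "u ** v" := (mul u v) (at level 40).

Definition alternative : Prop :=
  forall u v, (u ** u) ** v = u ** (u ** v) /\ (v ** u) ** u = v ** (u ** u).

(* A commutative ring is a Jordan ring if it satisfies this identity; as      *)
(* (Gr L, gr_mul) is commutative, failing the identity means not being Jordan.*)
Definition jordan : Prop :=
  forall u v, ((u ** u) ** v) ** u = (u ** u) ** (v ** u).

End NonassociativeRings.

(* Main.v *)
Require Import Defs.
From HB Require Import structures.
From mathcomp Require Import all_boot all_order all_algebra.
From mathcomp Require Import generic_quotient boolp classical_sets fsbigop.
From mathcomp Require Import freeg zify.

Set Implicit Arguments.
Unset Strict Implicit.
Unset Printing Implicit Defensive.

Import Order.TTheory GRing.Theory Num.Theory passmx.
Local Open Scope ring_scope.
Local Open Scope quotient_scope.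
Local Open Scope classical_set_scope.

(** Let V be a minimal nonzero ideal of the Lie algebra L_Lie. It is an
irreducible L-module, and its bracket V (x) V -> V is nonzero, since V would
otherwise give a solvable ideal of L outside Leib(L). Let V' be an irreducible
submodule of the dual of V; evaluation pairs V' and V into the trivial module.
Write p = [V_s], q = [V_a], r = [V'_s] for the symmetric and antisymmetric
bimodule structures. Products of a nontrivial symmetric and a nontrivial
antisymmetric irreducible class vanish, 1 occurs in rp, and q occurs in q^2.

For u = p + r one has uq = 0, hence u(uq) = 0, whereas (u^2)q contains q because
1 occurs in u^2. For u = p - q the coefficient of q in (u^2 r)u is at most 0,
since u^2 r is a nonnegative combination of symmetric classes, whereas in
u^2(ru) = (p^2 + q^2)(rp) it is positive, because q occurs in q^2 and 1 in rp.

Neither complete reducibility nor the full Jordan-Hoelder theorem is needed: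
all multiplicities enter only through their being zero or positive. *)

(** * Subquotients and composition series *)

Section Biactions.
Variables (F : fieldType) (L : leibnizAlgebra F).
Implicit Types V W : vectType F.

(** Equivariance is asked on [U] only, of a map defined on all of [V]; a stable [U] with such an [f]
    describes a subquotient of [X] without subspace types. *)
Definition hom_on V W (X : biaction L V) (Y : biaction L W) (U : {vspace V})
    (f : 'Hom(V, W)) : Prop :=
  forall x m, m \in U ->
    f (lact X x m) = lact Y x (f m) /\ f (ract X x m) = ract Y x (f m).

Lemma hom_onS V W (X : biaction L V) (Y : biaction L W) (U U' : {vspace V}) f :
  (U' <= U)%VS -> hom_on X Y U f -> hom_on X Y U' f.
Proof. by move=> /subvP sU hf x m /sU; apply: hf. Qed.

Lemma stable0 V (X : biaction L V) : stable X 0%VS.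
Proof. by move=> x m; rewrite memv0 => /eqP->; rewrite !linear0 mem0v. Qed.

Lemma stablef V (X : biaction L V) : stable X fullv.
Proof. by move=> x m _; rewrite !memvf. Qed.

Lemma stable_cap V (X : biaction L V) (U U' : {vspace V}) :
  stable X U -> stable X U' -> stable X (U :&: U').
Proof.
move=> sU sU' x m; rewrite !memv_cap => /andP[/(sU x)[-> ->]].
by move=> /(sU' x)[-> ->].
Qed.

Lemma stable_img V W (X : biaction L V) (Y : biaction L W) (U : {vspace V}) f :
  stable X U -> hom_on X Y U f -> stable Y (f @: U).
Proof.
move=> sU hf x w /memv_imgP[m mU ->]; have [<- <-] := hf x m mU.
by have [lU rU] := sU x m mU; split; apply: memv_img.
Qed.

Lemma stable_ker V W (X : biaction L V) (Y : biaction L W) (U : {vspace V}) f :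
  stable X U -> hom_on X Y U f -> stable X (U :&: lker f).
Proof.
move=> sU hf x m; rewrite !memv_cap memv_ker => /andP[mU /eqP fm0].
have [lU rU] := sU x m mU; have [lf rf] := hf x m mU.
by rewrite lU rU !memv_ker lf rf fm0 !linear0 eqxx.
Qed.

Lemma sub_biactionE V (X : biaction L V) (U : {vspace V}) : stable X U ->
  forall x w, vsval (lact (sub_biaction X U) x w) = lact X x (vsval w) /\
              vsval (ract (sub_biaction X U) x w) = ract X x (vsval w).
Proof.
move=> sU x w; have [lU rU] := sU x _ (subvsP w).
by split; rewrite /= /conj_act !comp_lfunE !lfunE /= vsprojK.
Qed.

(** Replaces the nested types in [section_biaction] by a linear map on [V] itself, whose kernel
    within [W] is [U]. *)
Lemma section_proj V (X : biaction L V) (U W : {vspace V}) :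
    stable X U -> stable X W ->
  exists q, [/\ hom_on X (section_biaction X U W) W q, (q @: W = fullv)%VS
    & forall m, m \in W -> (q m == 0) = (m \in U)].
Proof.
move=> sU sW; set U' := (linfun vsval @^-1: U)%VS : {vspace subvs_of W}.
have U'E w : (w \in U') = (vsval w \in U).
  by rewrite -memv_preim lfunE.
have sU' : stable (sub_biaction X W) U'.
  move=> x w; rewrite !U'E; have [-> ->] := sub_biactionE sW x w; exact: sU.
have eq := quot_proj_equivariant sU'.
pose q := (quot_proj U' \o linfun (vsproj W))%VF.
have qE m : q m = quot_proj U' (vsproj W m) by rewrite comp_lfunE [linfun _ m]lfunE.
exists q; split=> [x m mW||m mW].
- rewrite !qE; have [<- <-] := eq x (vsproj W m); have [lW rW] := sW x m mW.
  have [lE rE] := sub_biactionE sW x (vsproj W m).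
  by split; congr (quot_proj _ _); apply: val_inj; rewrite /= ?lE ?rE !vsprojK.
- apply/eqP; rewrite eqEsubv subvf; apply/subvP => s _.
  apply/memv_imgP; exists (vsval (vsval s)); first exact: subvsP.
  by rewrite qE vsvalK quot_projK.
- by rewrite qE -memv_ker lker_quot_proj U'E vsprojK.
Qed.

Lemma isomorphic_bij V W (X : biaction L V) (Y : biaction L W) f :
  hom_on X Y fullv f -> lker f = 0%VS -> limg f = fullv -> isomorphic X Y.
Proof.
move=> hf kf im_f; exists f; split; last by move=> x m; apply: hf (memvf m).
exists (f^-1)%VF; first by apply: lker0_lfunK; rewrite kf.
by move=> w; apply: limg_lfunVK; rewrite im_f memvf.
Qed.

Lemma isomorphic_sym V W (X : biaction L V) (Y : biaction L W) :
  isomorphic X Y -> isomorphic Y X.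
Proof.
move=> [f [f_bij fE]]; exists (f^-1)%VF.
have f0 : lker f == 0%VS by apply/lker0P; exact: bij_inj.
have fV : cancel (f^-1)%VF f.
  by case: f_bij => g fK gK w; rewrite -[w]gK lker0_lfunK.
split; first by exists f => //; exact: lker0_lfunK.
by move=> x m; split; rewrite -{1}[m]fV -?(fE _ _).1 -?(fE _ _).2 lker0_lfunK.
Qed.

Lemma isomorphic_trans V V' V'' (X : biaction L V) (Y : biaction L V')
    (Z : biaction L V'') :
  isomorphic X Y -> isomorphic Y Z -> isomorphic X Z.
Proof.
move=> [f [f_bij fE]] [g [g_bij gE]]; exists (g \o f)%VF; split.
  by apply: (eq_bij (bij_comp g_bij f_bij)) => m; rewrite comp_lfunE.
by move=> x m; rewrite !comp_lfunE (fE _ _).1 (fE _ _).2 (gE _ _).1 (gE _ _).2.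
Qed.

Lemma irreducible_iso V W (X : biaction L V) (Y : biaction L W) :
  isomorphic X Y -> irreducible X -> irreducible Y.
Proof.
move=> iXY [V0 irrX]; have [g [[f gK fK] gE]] := isomorphic_sym iXY.
have hg U : hom_on Y X U g by move=> x m _; apply: gE.
split=> [W0|U sU].
  apply: V0; apply/eqP; rewrite -subv0; apply/subvP => v _; rewrite -[v]fK.
  by have := memvf (f v); rewrite W0 memv0 => /eqP->; rewrite linear0 mem0v.
have [gU|gU] := irrX _ (stable_img sU (hg U)).
  left; apply/eqP; rewrite -subv0; apply/subvP => w wU; rewrite memv0 -[w]gK.
  have : g w \in 0%VS by rewrite -gU memv_img.
  by rewrite memv0 => /eqP->; rewrite -[0](linear0 g) gK.
right; apply/eqP; rewrite eqEsubv subvf; apply/subvP => w _.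
have : g w \in (g @: U)%VS by rewrite gU memvf.
by move=> /memv_imgP[u uU /(can_inj gK)->].
Qed.

(** Schur's argument: both images are everything, the kernel condition lets [f] factor through [q]
    on [Z], and the induced map [h] has a proper stable kernel, hence zero. *)
Lemma isomorphic_of_factor V W T (X : biaction L V) (Y : biaction L W)
    (S : biaction L T) (Z : {vspace V}) (f : 'Hom(V, W)) (q : 'Hom(V, T)) :
    stable X Z -> hom_on X Y Z f -> hom_on X S Z q ->
    irreducible Y -> irreducible S ->
    (f @: Z)%VS <> 0%VS -> (q @: Z)%VS <> 0%VS ->
    (forall m, m \in Z -> q m = 0 -> f m = 0) ->
  isomorphic S Y.
Proof.
move=> sZ hf hq [_ irrY] [_ irrS] fZ0 qZ0 qf.
have [//|fZ] := irrY _ (stable_img sZ hf).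
have [//|qZ] := irrS _ (stable_img sZ hq).
pose s := (q \o linfun vsval)%VF : 'Hom(subvs_of Z, T).
(* [s^-1] chooses a preimage under [q] in [Z]; any other choice differs by an element killed by [q],
   hence by [f]. *)
pose h := (f \o linfun vsval \o s^-1)%VF.
have hE m : m \in Z -> h (q m) = f m.
  move=> mZ; rewrite /h !comp_lfunE lfunE /=; set m' := vsval _.
  have m'Z : m' \in Z by apply: subvsP.
  have : q m' = q m.
    have -> : q m' = s (s^-1 (q m))%VF by rewrite !comp_lfunE !lfunE.
    apply: limg_lfunVK.
    have -> : q m = s (vsproj Z m) by rewrite comp_lfunE lfunE /= vsprojK.
    exact: memv_img (memvf _).
  move=> qmm; apply/eqP; rewrite -subr_eq0 -linearB; apply/eqP/qf.
    exact: rpredB.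
  by rewrite linearB /= qmm subrr.
have qsurj t : exists2 m, m \in Z & t = q m by apply/memv_imgP; rewrite qZ memvf.
have hh : hom_on S Y fullv h.
  move=> x t _; have [m mZ ->] := qsurj t.
  have [<- <-] := hq x m mZ; have [lZ rZ] := sZ x m mZ.
  by rewrite !hE //; apply: hf.
have hf0 : (h @: fullv = f @: Z)%VS.
  apply/vspaceP => w; apply/memv_imgP/memv_imgP => [[t _ ->]|[m mZ ->]].
    by have [m mZ ->] := qsurj t; exists m; rewrite ?hE.
  by exists (q m); rewrite ?memvf ?hE.
apply: (isomorphic_bij hh); last by rewrite hf0 fZ.
have := stable_ker (stablef S) hh; rewrite capfv => /irrS[//|kh].
case: fZ0; rewrite -hf0; apply/eqP; rewrite -subv0 -kh.
apply/subvP => w /memv_imgP[t _ ->]; move: (memvf t).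
by rewrite -kh memv_ker => /eqP->; apply: mem0v.
Qed.

Lemma stable_preim V W (X : biaction L V) (Y : biaction L W) (U : {vspace V})
    (T : {vspace W}) f :
  stable X U -> stable Y T -> hom_on X Y U f -> stable X (U :&: f @^-1: T).
Proof.
move=> sU sT hf x m; rewrite !memv_cap -!memv_preim => /andP[mU fmT].
by have [-> ->] := sU x m mU; have [-> ->] := hf x m mU; apply: sT.
Qed.

(** A stable subspace of least dimension strictly containing [U] works: a proper non-zero stable
    subspace of the section would pull back to a smaller one. *)
Lemma exists_irreducible_section V (X : biaction L V) (U : {vspace V}) :
    stable X U -> U <> fullv ->
  exists U' : {vspace V}, [/\ stable X U', (U <= U')%VS, ~~ (U' <= U)%VS
    & irreducible (section_biaction X U U')].
Proof.
move=> sU nU; pose P (U' : {vspace V}) :=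
  [/\ stable X U', (U <= U')%VS & ~~ (U' <= U)%VS].
pose Q k := `[< exists2 U', P U' & \dim U' = k >].
have exQ : exists k, Q k.
  exists (\dim (fullv : {vspace V})); apply/asboolP; exists fullv => //.
  split; [exact: stablef|exact: subvf|apply/negP => fU].
  by apply: nU; apply/eqP; rewrite eqEsubv subvf.
case: (ex_minnP exQ) => k /asboolP[U' [sU' UU' U'U] dU'] kmin.
exists U'; split=> //; have [q [hq qU' qU]] := section_proj sU sU'.
split=> [S0|T sT].
  case/subvP: U'U => m mU'; rewrite -qU // -memv0 -S0; exact: memvf.
have sZ := stable_preim sU' sT hq; set Z := (_ :&: _)%VS in sZ.
have UZ : (U <= Z)%VS.
  apply/subvP => m mU; have mU' := subvP UU' m mU.
  by move: mU; rewrite -qU // memv_cap mU' -memv_preim => /eqP->; rewrite mem0v.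
have [ZU|ZU] := boolP (Z <= U)%VS; [left|right].
  apply/eqP; rewrite -subv0; apply/subvP => t tT.
  have : t \in (q @: U')%VS by rewrite qU' memvf.
  move=> /memv_imgP[m mU' tE]; rewrite memv0 tE qU //.
  by apply: (subvP ZU); rewrite memv_cap mU' -memv_preim -tE.
have : Q (\dim Z) by apply/asboolP; exists Z.
move=> /kmin; rewrite -dU' => dU'Z.
have ZU' : Z = U' by apply/eqP; rewrite eqEdim dU'Z capvSl.
apply/eqP; rewrite eqEsubv subvf -qU'; apply/subvP => t /memv_imgP[m mU' ->].
have : m \in Z by rewrite ZU'.
by rewrite memv_cap -memv_preim => /andP[].
Qed.

Lemma exists_irreducible_sub V (X : biaction L V) :
    (fullv : {vspace V}) <> 0%VS ->
  exists2 U : {vspace V}, stable X U & irreducible (sub_biaction X U).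
Proof.
move=> V0.
have [|U [sU _ _ irrU]] := @exists_irreducible_section _ X 0%VS (stable0 X).
  by move=> /esym.
exists U => //; have [q [hq qU q0]] := section_proj (stable0 X) sU.
apply: irreducible_iso irrU; apply: isomorphic_sym.
have fE w : (q \o linfun vsval)%VF w = q (vsval w) :> subvs_of _.
  by rewrite comp_lfunE [linfun _ w]lfunE.
apply: (isomorphic_bij (f := (q \o linfun vsval)%VF)).
- move=> x w _; rewrite !fE; have [-> ->] := sub_biactionE sU x w.
  exact: hq (subvsP w).
- apply/eqP; rewrite -subv0; apply/subvP => w; rewrite memv_ker fE q0 ?subvsP //.
  by rewrite !memv0 => /eqP w0; apply/eqP/val_inj.
- apply/eqP; rewrite eqEsubv subvf -qU; apply/subvP => t /memv_imgP[m mU ->].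
  by apply/memv_imgP; exists (vsproj U m); rewrite ?memvf // fE vsprojK.
Qed.

Lemma exists_composition_series V (X : biaction L V) :
  exists n c, composition_series X n c.
Proof.
suff series k (U : {vspace V}) : stable X U -> (\dim {:V} - \dim U <= k)%N ->
    exists n c, [/\ c 0%N = U, c n = fullv & forall i, (i < n)%N ->
      [/\ (c i <= c i.+1)%VS, stable X (c i), stable X (c i.+1) &
          irreducible (section_biaction X (c i) (c i.+1))]].
  exact: series (stable0 X) (leqnn _).
elim: k U => [|k IHk] U sU dU.
  exists 0%N, (fun=> U); split=> //; apply/eqP.
  by rewrite eqEdim subvf -subn_eq0 -leqn0.
have [Uf|Uf] := pselect (U = fullv); first by exists 0%N, (fun=> U).
have [U' [sU' UU' nU'U irrU]] := exists_irreducible_section sU Uf.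
have [|n [c [c0 cn cE]]] := IHk U' sU'.
  have : (\dim U < \dim U')%N.
    rewrite ltnNge; apply: contra nU'U => dU'U.
    by rewrite (eqP (_ : U == U')) // eqEdim UU'.
  by move: dU (dimvS (subvf U')); lia.
exists n.+1, (fun i => if i is j.+1 then c j else U); split=> // -[|i] /= ltin.
  by rewrite c0.
exact: cE.
Qed.

(** Take the first term of the series on whose intersection with [Z] the map [f] is non-zero. There
    [f] kills the part lying in the preceding term, so it factors through the section. *)
Lemma composition_series_factor V W (X : biaction L V) (Y : biaction L W) n c
    (Z : {vspace V}) f :
    composition_series X n c -> stable X Z -> hom_on X Y Z f ->
    irreducible Y -> (f @: Z)%VS <> 0%VS ->
  exists i : 'I_n, isomorphic (section_biaction X (c i) (c i.+1)) Y.
Proof.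
move=> [c0 cn cE] sZ hf irrY fZ.
have exP : exists i, (f @: (Z :&: c i) != 0)%VS.
  by exists n; rewrite cn capvf; apply/eqP.
case: (ex_minnP exP) => -[|i] fi imin; first by rewrite c0 capv0 limg0 eqxx in fi.
have ltin : (i < n)%N by apply: imin; rewrite cn capvf; apply/eqP.
have fi0 : (f @: (Z :&: c i) = 0)%VS.
  by apply/eqP; apply: contraT => /imin; rewrite ltnn.
exists (Ordinal ltin) => /=; have [_ si si1 irrS] := cE i ltin.
have [q [hq _ q0]] := section_proj si si1.
have sZi := stable_cap sZ si1.
have ker_qf m : m \in (Z :&: c i.+1)%VS -> q m = 0 -> f m = 0.
  rewrite memv_cap => /andP[mZ mi1] /eqP; rewrite q0 // => mi.
  by apply/eqP; rewrite -memv0 -fi0 memv_img // memv_cap mZ.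
apply: (isomorphic_of_factor sZi (hom_onS (capvSl _ _) hf)
  (hom_onS (capvSr _ _) hq) irrY irrS _ _ ker_qf); first exact/eqP.
move=> qZ; move/eqP: fi; apply; apply/eqP; rewrite -subv0.
apply/subvP => _ /memv_imgP[m mZ ->]; rewrite memv0; apply/eqP/ker_qf => //.
by apply/eqP; rewrite -memv0 -qZ memv_img.
Qed.

(** Composition series exist, so [xget] returns an actual count rather than its default [0]. *)
Lemma multiplicity_gt0 V W (X : biaction L V) (Y : biaction L W) f :
    hom_on X Y fullv f -> irreducible Y -> f <> 0 ->
  (0 < multiplicity X Y)%N.
Proof.
move=> hf irrY f0; rewrite /multiplicity; case: xgetP => [k -> [n [c [Xc ->]]]|].
  have fV : limg f <> 0%VS.
    move=> fV; apply: f0; apply/lfunP => m; apply/eqP.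
    by rewrite zero_lfunE -memv0 -fV memv_img ?memvf.
  have [i iE] := composition_series_factor Xc (stablef X) hf irrY fV.
  by apply/card_gt0P; exists i; rewrite inE; apply/asboolP.
have [n [c Xc]] := exists_composition_series X.
by move=> /(_ _ (ex_intro _ n (ex_intro _ c (conj Xc erefl)))).
Qed.

(** A factor isomorphic to [Y] exhibits [Y] as an image of the upper term of that factor. Identities
    such as symmetry thus pass from [X] to [Y]. *)
Lemma multiplicity_gt0_hom V W (X : biaction L V) (Y : biaction L W) :
    (0 < multiplicity X Y)%N ->
  exists (Z : {vspace V}) f,
    [/\ stable X Z, hom_on X Y Z f & (f @: Z = fullv)%VS].
Proof.
rewrite /multiplicity; case: xgetP => // k -> [n [c [[_ _ cE] ->]]].
move=> /card_gt0P[i]; rewrite inE => /asboolP[g [g_bij gE]].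
have [_ si si1 _] := cE i (ltn_ord i).
have [q [hq qc _]] := section_proj si si1.
exists (c i.+1), (g \o q)%VF; split=> //.
  by move=> x m mc; rewrite !comp_lfunE; have [-> ->] := hq x m mc; apply: gE.
rewrite limg_comp qc; apply/eqP; rewrite eqEsubv subvf; apply/subvP => w _.
by have [h _ hK] := g_bij; rewrite -[w]hK memv_img ?memvf.
Qed.

(** [multiplicity] may count in a different series for each [Y]; one fixed series still meets every
    irreducible of positive multiplicity, so finitely many classes occur. *)
Lemma multiplicity_factor V (X : biaction L V) : exists n c,
  composition_series X n c /\
  forall W (Y : biaction L W), irreducible Y -> (0 < multiplicity X Y)%N ->
    exists i : 'I_n, isomorphic (section_biaction X (c i) (c i.+1)) Y.
Proof.
have [n [c Xc]] := exists_composition_series X.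
exists n, c; split=> // W Y irrY /multiplicity_gt0_hom[Z [f [sZ hf fZ]]].
by apply: (composition_series_factor Xc sZ hf irrY); rewrite fZ; case: irrY.
Qed.

Definition symmetric_act V (X : biaction L V) :=
  forall x m, ract X x m = - lact X x m.

Definition antisymmetric_act V (X : biaction L V) :=
  forall x m, ract X x m = 0.

Definition trivial_act V (X : biaction L V) :=
  forall x m, lact X x m = 0.

Lemma symmetric_multiplicity V W (X : biaction L V) (Y : biaction L W) :
  symmetric_act X -> (0 < multiplicity X Y)%N -> symmetric_act Y.
Proof.
move=> symX /multiplicity_gt0_hom[Z [f [_ hf fZ]]] x w.
have : w \in (f @: Z)%VS by rewrite fZ memvf.
by move=> /memv_imgP[m mZ ->]; have [<- <-] := hf x m mZ; rewrite symX linearN.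
Qed.

Lemma antisymmetric_multiplicity V W (X : biaction L V) (Y : biaction L W) :
  antisymmetric_act X -> (0 < multiplicity X Y)%N -> antisymmetric_act Y.
Proof.
move=> symX /multiplicity_gt0_hom[Z [f [_ hf fZ]]] x w.
have : w \in (f @: Z)%VS by rewrite fZ memvf.
by move=> /memv_imgP[m mZ ->]; have [_ <-] := hf x m mZ; rewrite symX linear0.
Qed.

Lemma multiplicity0 V W (X : biaction L V) (Y : biaction L W) :
  irreducible Y -> (fullv : {vspace V}) = 0%VS -> multiplicity X Y = 0%N.
Proof.
move=> [Y0 _] X0; apply/eqP; rewrite -leqn0 leqNgt; apply/negP.
move=> /multiplicity_gt0_hom[Z [f [_ _ fZ]]]; apply: Y0; rewrite -fZ.
have /eqP-> : (Z == 0)%VS by rewrite -subv0 -X0 subvf.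
exact: limg0.
Qed.
End Biactions.

(** * Truncated tensor products *)

Section TruncatedTensor.
Variables (F : fieldType) (L : leibnizAlgebra F).
Implicit Types V W : vectType F.

Lemma tens_lfunP V W (T : vectType F) (f g : 'Hom(tensor V W, T)) :
  (forall v w, f (tens v w) = g (tens v w)) -> f = g.
Proof. by move=> fg; apply/lfunP; apply: tens_eq. Qed.

Lemma tensNl V W (v : V) (w : W) : tens (- v) w = - tens v w.
Proof. by apply/matrixP => i j; rewrite !mxE linearN mulNr. Qed.

Lemma tensNr V W (v : V) (w : W) : tens v (- w) = - tens v w.
Proof. by apply/matrixP => i j; rewrite !mxE linearN mulrN. Qed.

Lemma tens0l V W (w : W) : tens (0 : V) w = 0.
Proof. by apply/matrixP => i j; rewrite !mxE linear0 mul0r. Qed.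

Lemma tens0r V W (v : V) : tens v (0 : W) = 0.
Proof. by apply/matrixP => i j; rewrite !mxE linear0 mulr0. Qed.

Lemma tens_vspace V W (T : {vspace tensor V W}) :
  (forall v w, tens v w \in T) -> T = fullv.
Proof.
move=> vwT; rewrite -[T]lker_quot_proj.
suff -> : quot_proj T = 0.
  by apply/vspaceP => t; rewrite memv_ker zero_lfunE eqxx memvf.
by apply: tens_lfunP => v w; apply/eqP; rewrite zero_lfunE -memv_ker lker_quot_proj.
Qed.

Lemma quot_symmetric V (X : biaction L V) U :
  symmetric_act X -> symmetric_act (quot_biaction X U).
Proof.
by move=> symX x m; rewrite /= /conj_act !comp_lfunE symX !linearN.
Qed.

Lemma quot_antisymmetric V (X : biaction L V) U :
  antisymmetric_act X -> antisymmetric_act (quot_biaction X U).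
Proof.
by move=> symX x m; rewrite /= /conj_act !comp_lfunE symX !linear0.
Qed.

Lemma trunc_symmetric V W (M : biaction L V) (N : biaction L W) :
  symmetric_act M -> symmetric_act N -> symmetric_act (trunc_tensor M N).
Proof.
move=> sM sN; apply: quot_symmetric => x t; rewrite -opp_lfunE.
congr (fun_of_lfun _ t); apply: tens_lfunP => v w.
by rewrite opp_lfunE /= !tens_actE sM sN tensNl tensNr opprD.
Qed.

Lemma trunc_antisymmetric V W (M : biaction L V) (N : biaction L W) :
  antisymmetric_act M -> antisymmetric_act N -> antisymmetric_act (trunc_tensor M N).
Proof.
move=> aM aN; apply: quot_antisymmetric => x t.
suff -> : ract (tensor_biaction M N) x = 0 by rewrite zero_lfunE.
apply: tens_lfunP => v w.
by rewrite zero_lfunE /= !tens_actE aM aN tens0l tens0r addr0.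
Qed.

(** A subspace containing all [lact M x m] is automatically stable, and it cannot be zero when the
    action is non-trivial. *)
Lemma act_image_full V (M : biaction L V) (U : {vspace V}) :
    irreducible M -> symmetric_act M \/ antisymmetric_act M -> ~ trivial_act M ->
  (forall x m, lact M x m \in U) -> U = fullv.
Proof.
move=> [_ irrM] rM ntM MU; have [|U0|//] := irrM U.
  move=> x m _; split=> //; case: rM => -> //; last exact: mem0v.
  by rewrite rpredN.
by case: ntM => x m; apply/eqP; rewrite -memv0 -U0.
Qed.

(** Up to sign, the truncation generators collapse to [tens (lact M x m) (lact N y n)]. By
    [act_image_full] in each factor, these span the whole tensor product. *)
Lemma trunc_eq0 V W (M : biaction L V) (N : biaction L W) :
    irreducible M -> irreducible N ->
    symmetric_act M /\ antisymmetric_act N \/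
    antisymmetric_act M /\ symmetric_act N ->
    ~ trivial_act M -> ~ trivial_act N ->
  (fullv : {vspace subvs_of (trunc_sub M N)^C}) = 0%VS.
Proof.
move=> irrM irrN MN ntM ntN.
have [sM sN] : (symmetric_act M \/ antisymmetric_act M) /\
    (symmetric_act N \/ antisymmetric_act N) by case: MN => -[]; auto.
have [_ TG _] := generatedP (tensor_biaction M N) (trunc_gens M N).
rewrite -/(trunc_sub M N) in TG; set T := trunc_sub M N in TG *.
have actT x y m n : tens (lact M x m) (lact N y n) \in T.
  case: MN => -[rM rN].
    (* Only the second summand of the generator survives here; its indices stand in the opposite
       order, so [x] and [y] are exchanged. *)
    have := TG _ (ex_intro _ y (ex_intro _ x (ex_intro _ m (ex_intro _ n erefl)))).
    by rewrite !rM !rN subrr tens0l add0r addr0 tensNl rpredN.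
  have := TG _ (ex_intro _ x (ex_intro _ y (ex_intro _ m (ex_intro _ n erefl)))).
  by rewrite !rM !rN subrr tens0r !addr0 tensNr rpredN.
(* For fixed [y] and [n], the [v] with this property form a subspace containing every
   [lact M x m]. *)
have T1 v y n : tens v (lact N y n) \in T.
  pose f : {linear V -> tensor V W} := HB.pack (fun v => tens v (lact N y n))
    (GRing.isLinear.Build F V (tensor V W) *:%R _ (tens_linearl (lact N y n))).
  have fE u : (u \in linfun f @^-1: T)%VS = (tens u (lact N y n) \in T).
    by rewrite -memv_preim lfunE.
  rewrite -fE (act_image_full (U := linfun f @^-1: T) irrM) ?memvf // => x m.
  by rewrite fE.
have -> : T = fullv.
  apply: tens_vspace => v w.
  pose f : {linear W -> tensor V W} := HB.pack (tens v)
    (GRing.isLinear.Build F W (tensor V W) *:%R _ (tens_linearr v)).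
  have fE u : (u \in linfun f @^-1: T)%VS = (tens v u \in T).
    by rewrite -memv_preim lfunE.
  rewrite -fE (act_image_full (U := linfun f @^-1: T) irrN) ?memvf // => y n.
  by rewrite fE.
apply/eqP; rewrite -subv0; apply/subvP => w _; rewrite memv0.
by rewrite -[w]quot_projK -memv_ker lker_quot_proj memvf.
Qed.

(** The bilinear form of a homomorphism from the truncated tensor product to [Y]; the last clause
    says that [trunc_gens] is sent to zero. *)
Definition equivariant_pairing V W T (M : biaction L V) (N : biaction L W)
    (Y : biaction L T) (b : V -> W -> T) : Prop :=
  [/\ (forall w, linear (b^~ w)) /\ (forall v, linear (b v)),
      forall x v w, lact Y x (b v w) = b (lact M x v) w + b v (lact N x w),
      forall x v w, ract Y x (b v w) = b (ract M x v) w + b v (ract N x w)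
    & forall x y v w, b (lact M x v + ract M x v) (ract N y w)
                      + b (ract M y v) (lact N x w + ract N x w) = 0].

(** The lift of [b] has a stable kernel containing the generators, hence containing [trunc_sub] by
    minimality. It descends to a non-zero homomorphism onto which [multiplicity_gt0] applies. *)
Lemma trunc_multiplicity_gt0 V W T (M : biaction L V) (N : biaction L W)
    (Y : biaction L T) b :
    equivariant_pairing M N Y b -> irreducible Y -> (exists v w, b v w != 0) ->
  (0 < multiplicity (trunc_tensor M N) Y)%N.
Proof.
move=> [[bl br] eql eqr b0] irrY [v [w bvw]]; set X := tensor_biaction M N.
pose f := linfun (tens_lift b) : 'Hom(tensor V W, T).
have fE v' w' : f (tens v' w') = b v' w' by rewrite lfunE /= tens_liftE.
have hl x : (f \o lact X x = lact Y x \o f)%VF.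
  apply: tens_lfunP => v' w'.
  by rewrite !comp_lfunE fE eql /= tens_actE linearD /= !fE.
have hr x : (f \o ract X x = ract Y x \o f)%VF.
  apply: tens_lfunP => v' w'.
  by rewrite !comp_lfunE fE eqr /= tens_actE linearD /= !fE.
have hf : hom_on X Y fullv f.
  by move=> x t _; rewrite -!comp_lfunE hl hr.
have [_ _ Tmin] := generatedP X (trunc_gens M N).
rewrite -/(trunc_sub M N) in Tmin; set S := trunc_sub M N in Tmin *.
have Tf t : t \in S -> f t = 0.
  move=> tS; apply/eqP; rewrite -memv_ker; apply: subvP t tS; apply: Tmin.
    by have := stable_ker (stablef X) hf; rewrite capfv.
  move=> _ [x [y [m [n ->]]]]; rewrite memv_ker linearD /= !fE b0 //.
have fS t : f (vsval (quot_proj S t)) = f t.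
  apply/eqP; rewrite -subr_eq0 -linearB; apply/eqP/Tf.
  suff : vsval (quot_proj S t) - t \in lker (quot_proj S) by rewrite lker_quot_proj.
  by rewrite memv_ker linearB /= quot_projK subrr.
pose g := (f \o linfun vsval)%VF : 'Hom(subvs_of S^C, T).
have gE t : g (quot_proj S t) = f t.
  by rewrite (comp_lfunE f) [linfun vsval _]lfunE fS.
apply: (multiplicity_gt0 (f := g)) => // [x u _|g0].
  have [l r] := quot_proj_equivariant (@trunc_sub_stable _ _ _ _ M N) x (vsval u).
  rewrite -[u]quot_projK -l -r !gE; exact: hf (memvf _).
by move: bvw; rewrite -fE -gE g0 zero_lfunE eqxx.
Qed.

(** Representatives of classes are only isomorphic to the concrete bimodules on which pairings are
    built, so pairings must be transported. *)
Lemma equivariant_pairing_iso V W T V' W' T' (M : biaction L V) (N : biaction L W)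
    (Y : biaction L T) (M' : biaction L V') (N' : biaction L W')
    (Y' : biaction L T') b :
    isomorphic M' M -> isomorphic N' N -> isomorphic Y Y' ->
    equivariant_pairing M N Y b -> (exists v w, b v w != 0) ->
  exists2 b', equivariant_pairing M' N' Y' b' & exists v w, b' v w != 0.
Proof.
move=> [f [[fV fK fVK] fE]] [g [[gV gK gVK] gE]] [h [h_bij hE]] [[bl br] eql eqr b0].
move=> [v [w vw]]; exists (fun v w => h (b (f v) (g w))); last first.
  exists (fV v), (gV w); rewrite fVK gVK; apply: contra vw => /eqP h0.
  by apply/eqP; apply: (bij_inj h_bij); rewrite h0 linear0.
split=> [||x u u'|x y u u'].
- by split=> u a u1 u2; rewrite linearP ?bl ?br linearP.
- move=> x u u'; rewrite -(hE _ _).1 eql (fE _ _).1 (gE _ _).1.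
  exact: linearD.
- rewrite -(hE _ _).2 eqr (fE _ _).2 (gE _ _).2; exact: linearD.
- rewrite (linearD f) (linearD g) /= !(fE _ _).1 !(fE _ _).2 !(gE _ _).1 !(gE _ _).2.
  by rewrite -linearD b0 linear0.
Qed.
End TruncatedTensor.

(** * The Grothendieck ring *)

Section Grothendieck.
Variables (F : fieldType) (L : leibnizAlgebra F).
Implicit Types V W : vectType F.

Lemma bimodule_iso V W (X : biaction L V) (Y : biaction L W) :
  isomorphic X Y -> is_bimodule X -> is_bimodule Y.
Proof.
move=> [f [[g fK gK] fE]] [LLM LML MLL].
have eql x m := (fE x m).1; have eqr x m := (fE x m).2.
by split=> x y m; rewrite -[m]gK -!(eql, eqr, linearB) ?(LLM, LML, MLL).
Qed.

Lemma irr_class_exists V (X : biaction L V) : is_bimodule X -> irreducible X ->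
  exists a : Irr L, isomorphic (irr_repr a) X.
Proof.
move=> bX irrX; have eV := vbasisP {:V}.
pose f : 'Hom('rV[F]_(\dim {:V}), V) := linfun (vecof (vbasis {:V})).
pose g : 'Hom(V, 'rV[F]_(\dim {:V})) := linfun (rVof (vbasis {:V})).
have fg : cancel f g by move=> u; rewrite !lfunE /= (vecofK eV).
have gf : cancel g f by move=> v; rewrite !lfunE /= (rVofK eV).
have iXY : isomorphic X (transport f g X).
  exists g; split; first by exists f.
  by move=> x m; split; rewrite /= /conj_act !comp_lfunE gf.
pose Y := IrrBimodule (bimodule_iso iXY bX) (irreducible_iso iXY irrX).
exists (\pi_(Irr L) (Y : {classic irrBimodule L})).
apply: isomorphic_trans (isomorphic_sym iXY).
by have /eqmodP/asboolP := reprK (\pi_(Irr L) (Y : {classic irrBimodule L})).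
Qed.

Lemma irr_repr_inj (a b : Irr L) : isomorphic (irr_repr a) (irr_repr b) -> a = b.
Proof.
by move=> ab; rewrite -[a]reprK -[b]reprK; apply/eqmodP/asboolP.
Qed.

(** The sum in [gr_class] has its intended value only if its support is finite; a finite list of
    classes is read off from the factors of one composition series. *)
Lemma coeff_gr_class V (X : biaction L V) (b : Irr L) :
  coeff b (gr_class X) = (multiplicity X (irr_repr b))%:Z.
Proof.
have [n [c [_ Xc]]] := multiplicity_factor X.
(* [s] sends the index of a factor to its class, or to [None] if no class matches, as may happen
   when [X] is not a bimodule. *)
have /choice[s sE] (i : 'I_n) : exists o : option (Irr L), forall a,
    isomorphic (section_biaction X (c i) (c i.+1)) (irr_repr a) -> o = Some a.
  have [[a ia]|nia] := pselect (exists a : Irr L,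
      isomorphic (section_biaction X (c i) (c i.+1)) (irr_repr a)).
    exists (Some a) => a' ia'; congr Some; apply: irr_repr_inj.
    exact: isomorphic_trans (isomorphic_sym ia) ia'.
  by exists None => a ia; case: nia; exists a.
pose r := undup (pmap s (enum 'I_n)).
have rE a : a \notin r -> multiplicity X (irr_repr a) = 0%N.
  rewrite mem_undup; apply: contraNeq; rewrite -lt0n.
  move=> /(Xc _ _ (irr_irreducible _))[i /sE si].
  by rewrite mem_pmap; apply/mapP; exists i; rewrite ?mem_enum.
rewrite /gr_class (fsbigE r) ?undup_uniq //; last first.
  by move=> a _ /rE->; rewrite freegU0.
rewrite raddf_sum /=; under eq_bigr => a _ do rewrite coeffU.
rewrite big_mkcond /=; under eq_bigr => a _ do rewrite mem_set //.
have [br|/rE m0] := boolP (b \in r).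
  rewrite (bigD1_seq b) ?undup_uniq //= eqxx mulr1 big1 ?addr0 // => a /negPf->.
  by rewrite mulr0.
rewrite m0 big1_seq // => a; have [->|] := eqVneq a b; last by rewrite mulr0.
by rewrite m0 mul0r.
Qed.

Lemma coeff_gr_mul (u v : Gr L) (b : Irr L) :
  coeff b (gr_mul u v) = \sum_(a <- dom u) \sum_(c <- dom v)
    (multiplicity (trunc_tensor (irr_repr a) (irr_repr c)) (irr_repr b))%:Z
      * (coeff a u * coeff c v).
Proof.
rewrite raddf_sum; apply: eq_bigr => a _; rewrite raddf_sum.
by apply: eq_bigr => c _; rewrite raddfMz /= coeff_gr_class mulrzz.
Qed.

Lemma sum_dom (T : choiceType) (u : {freeg T}) (r : seq T) (f : T -> int) :
    uniq r -> {subset dom u <= r} ->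
  \sum_(a <- dom u) f a * coeff a u = \sum_(a <- r) f a * coeff a u.
Proof.
move=> r_uniq ur; rewrite [RHS](bigID (mem (dom u))) /=.
rewrite [X in _ = _ + X]big1; last first.
  by move=> a /coeff_outdom->; rewrite mulr0.
rewrite addr0 -[RHS]big_filter; apply: perm_big.
apply: uniq_perm; rewrite ?uniq_dom ?filter_uniq // => a.
by rewrite mem_filter /=; case: (boolP (a \in dom u)) => // /ur->.
Qed.

(** Cancellation can shrink [dom (u - v)], so all three sums are extended to a common list. *)
Lemma sum_domB (T : choiceType) (u v : {freeg T}) (f : T -> int) :
  \sum_(a <- dom (u - v)) f a * coeff a (u - v)
    = \sum_(a <- dom u) f a * coeff a u - \sum_(a <- dom v) f a * coeff a v.
Proof.
set r := undup (dom u ++ dom v).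
rewrite !(@sum_dom _ _ r) ?undup_uniq //; last 3 first.
- by move=> a /domB; rewrite mem_undup.
- by move=> a av; rewrite mem_undup mem_cat av orbT.
- by move=> a au; rewrite mem_undup mem_cat au.
by rewrite -sumrB; apply: eq_bigr => a _; rewrite coeffB mulrBr.
Qed.

(** A coefficient of the product is a sum of the coefficients of the left factor with weights [f]
    independent of that factor. *)
Lemma gr_mulBl (u v w : Gr L) : gr_mul (u - v) w = gr_mul u w - gr_mul v w.
Proof.
apply/eqP/freeg_eqP => b; rewrite coeffB !coeff_gr_mul.
pose f a := \sum_(c <- dom w)
  (multiplicity (trunc_tensor (irr_repr a) (irr_repr c)) (irr_repr b))%:Z
    * coeff c w.
have fE t : \sum_(a <- dom t) \sum_(c <- dom w)
    (multiplicity (trunc_tensor (irr_repr a) (irr_repr c)) (irr_repr b))%:Z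
      * (coeff a t * coeff c w) = \sum_(a <- dom t) f a * coeff a t.
  apply: eq_bigr => a _; rewrite mulr_suml; apply: eq_bigr => c _.
  by rewrite [coeff a t * _]mulrC mulrA.
by rewrite !fE sum_domB.
Qed.

Lemma gr_mulBr (u v w : Gr L) : gr_mul w (u - v) = gr_mul w u - gr_mul w v.
Proof.
apply/eqP/freeg_eqP => b; rewrite coeffB !coeff_gr_mul -sumrB.
apply: eq_bigr => a _.
pose f c := (multiplicity (trunc_tensor (irr_repr a) (irr_repr c)) (irr_repr b))%:Z
  * coeff a w.
have fE t : \sum_(c <- dom t)
    (multiplicity (trunc_tensor (irr_repr a) (irr_repr c)) (irr_repr b))%:Z
      * (coeff a w * coeff c t) = \sum_(c <- dom t) f c * coeff c t.
  by apply: eq_bigr => c _; rewrite mulrA.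
by rewrite !fE sum_domB.
Qed.

Lemma gr_mul0r (u : Gr L) : gr_mul u 0 = 0.
Proof. by rewrite -[X in gr_mul _ X](subrr 0) gr_mulBr subrr. Qed.

Lemma gr_mulDl (u v w : Gr L) : gr_mul (u + v) w = gr_mul u w + gr_mul v w.
Proof. by apply/eqP; rewrite -subr_eq -gr_mulBl addrK. Qed.

Lemma gr_mulDr (u v w : Gr L) : gr_mul w (u + v) = gr_mul w u + gr_mul w v.
Proof. by apply/eqP; rewrite -subr_eq -gr_mulBr addrK. Qed.

(** * Signs and supports of coefficients *)

Definition gr_nonneg (u : Gr L) : Prop := forall a, 0 <= coeff a u.

Definition gr_supported (P : Irr L -> Prop) (u : Gr L) : Prop :=
  forall a, coeff a u != 0 -> P a.

Lemma gr_nonneg1 (a : Irr L) : gr_nonneg << a >>.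
Proof. by move=> b; rewrite coeffU mul1r. Qed.

Lemma gr_nonnegD (u v : Gr L) : gr_nonneg u -> gr_nonneg v -> gr_nonneg (u + v).
Proof. by move=> u0 v0 a; rewrite coeffD addr_ge0. Qed.

Lemma gr_nonneg_mul (u v : Gr L) :
  gr_nonneg u -> gr_nonneg v -> gr_nonneg (gr_mul u v).
Proof.
move=> u0 v0 b; rewrite coeff_gr_mul sumr_ge0 // => a _; rewrite sumr_ge0 // => c _.
by rewrite !mulr_ge0.
Qed.

(** All terms of the coefficient are non-negative, so nothing cancels the positive term at [a] and
    [c]. *)
Lemma gr_mul_gt0 (u v : Gr L) (a c b : Irr L) :
    gr_nonneg u -> gr_nonneg v -> 0 < coeff a u -> 0 < coeff c v ->
    (0 < multiplicity (trunc_tensor (irr_repr a) (irr_repr c)) (irr_repr b))%N ->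
  0 < coeff b (gr_mul u v).
Proof.
move=> u0 v0 au cv m0; rewrite coeff_gr_mul.
rewrite (bigD1_seq a) ?uniq_dom ?mem_dom ?lt0r_neq0 //=; apply: ltr_wpDr.
  by rewrite sumr_ge0 // => a' _; rewrite sumr_ge0 // => c' _; rewrite !mulr_ge0.
rewrite (bigD1_seq c) ?uniq_dom ?mem_dom ?lt0r_neq0 //=; apply: ltr_wpDr.
  by rewrite sumr_ge0 // => c' _; rewrite !mulr_ge0.
by rewrite !mulr_gt0.
Qed.

Lemma gr_supported1 (P : Irr L -> Prop) (a : Irr L) : P a -> gr_supported P << a >>.
Proof.
by move=> Pa b; rewrite coeffU mul1r; have [<-|] := eqVneq a b.
Qed.

Lemma gr_supportedD (P : Irr L -> Prop) (u v : Gr L) :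
  gr_supported P u -> gr_supported P v -> gr_supported P (u + v).
Proof.
move=> Pu Pv a; rewrite coeffD; have [->|/Pu//] := eqVneq (coeff a u) 0.
by rewrite add0r => /Pv.
Qed.

Lemma gr_supported_mul (P Q R : Irr L -> Prop) (u v : Gr L) :
    (forall a c b, P a -> Q c ->
      (0 < multiplicity (trunc_tensor (irr_repr a) (irr_repr c)) (irr_repr b))%N ->
      R b) ->
  gr_supported P u -> gr_supported Q v -> gr_supported R (gr_mul u v).
Proof.
move=> PQR Pu Qv b /eqP; apply: contra_notP => nRb.
rewrite coeff_gr_mul big1_seq // => a /andP[_]; rewrite mem_dom => /Pu Pa.
rewrite big1_seq // => c /andP[_]; rewrite mem_dom => /Qv Qc.
have [/(PQR _ _ _ Pa Qc)//|] := ltnP 0 (multiplicity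
  (trunc_tensor (irr_repr a) (irr_repr c)) (irr_repr b)).
by rewrite leqn0 => /eqP->; rewrite mul0r.
Qed.

Lemma gr_supported_eq0 (u : Gr L) : gr_supported (fun=> False) u -> u = 0.
Proof.
move=> u0; apply/eqP/freeg_eqP => a; rewrite coeff0.
by have [//|/u0] := eqVneq (coeff a u) 0.
Qed.

End Grothendieck.

(** * Symmetric and antisymmetric bimodules *)

Section Representations.
Variables (F : fieldType) (L : leibnizAlgebra F).
Implicit Types V W : vectType F.

Definition is_rep V (rho : {linear L -> 'End(V)}) : Prop :=
  forall x y v, rho (lbr L x y) v = rho x (rho y v) - rho y (rho x v).

Definition sym_biaction V (rho : {linear L -> 'End(V)}) : biaction L V :=
  Biaction rho (\- rho).

Definition anti_biaction V (rho : {linear L -> 'End(V)}) : biaction L V :=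
  Biaction rho \0.

Lemma sym_biactionP V (rho : {linear L -> 'End(V)}) :
  symmetric_act (sym_biaction rho).
Proof. by move=> x m; rewrite /= opp_lfunE. Qed.

Lemma anti_biactionP V (rho : {linear L -> 'End(V)}) :
  antisymmetric_act (anti_biaction rho).
Proof. by move=> x m; rewrite /= zero_lfunE. Qed.

Lemma sym_bimodule V (rho : {linear L -> 'End(V)}) :
  is_rep rho -> is_bimodule (sym_biaction rho).
Proof.
move=> rhoP; split=> x y m; rewrite ?sym_biactionP /= ?rhoP //.
  by rewrite linearN /= opprK addKr.
by rewrite !linearN /= !opprK opprB subrK.
Qed.

Lemma anti_bimodule V (rho : {linear L -> 'End(V)}) :
  is_rep rho -> is_bimodule (anti_biaction rho).
Proof.
move=> rhoP; split=> x y m; rewrite ?anti_biactionP /=.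
all: by rewrite ?rhoP ?zero_lfunE ?linear0 ?addr0.
Qed.

Lemma irreducible_stable V (X Y : biaction L V) :
  (forall U, stable Y U -> stable X U) -> irreducible X -> irreducible Y.
Proof. by move=> YX [V0 irrX]; split=> // U /YX; apply: irrX. Qed.

(** Stability for [anti_biaction] concerns [rho] alone, so irreducibility of this bimodule stands
    for irreducibility of the representation. *)
Lemma sym_irreducible V (rho : {linear L -> 'End(V)}) :
  irreducible (anti_biaction rho) -> irreducible (sym_biaction rho).
Proof.
apply: irreducible_stable => U sU x m mU; rewrite anti_biactionP mem0v.
by have [] := sU x m mU.
Qed.

Lemma exists_irreducible_subrep V (rho : {linear L -> 'End(V)}) :
    is_rep rho -> (fullv : {vspace V}) <> 0%VS ->
  exists (U : {vspace V}) (sigma : {linear L -> 'End(subvs_of U)}),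
    [/\ is_rep sigma, irreducible (anti_biaction sigma)
      & forall x u, vsval (sigma x u) = rho x (vsval u)].
Proof.
move=> rhoP /(@exists_irreducible_sub _ _ _ (anti_biaction rho))[U sU irrU].
pose sigma := lact (sub_biaction (anti_biaction rho) U).
have sE x u : vsval (sigma x u) = rho x (vsval u).
  by have [] := sub_biactionE sU x u.
exists U, sigma; split=> //.
  by move=> x y u; apply: val_inj; rewrite /= !sE rhoP.
apply: irreducible_stable irrU => T sT x m mT.
have [lT _] := sT x m mT; split=> //.
suff -> : ract (sub_biaction (anti_biaction rho) U) x m = 0 by apply: mem0v.
by apply/val_inj/(etrans (sub_biactionE sU x m).2); rewrite anti_biactionP.
Qed.

(** * The dual representation and evaluation *)

Section Dual.
Variables (V : vectType F) (rho : {linear L -> 'End(V)}).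

(** The contragredient action, with [F^o] the field as a vector space over itself. *)
Definition precomp_opp (x : L) (phi : 'Hom(V, F^o)) : 'Hom(V, F^o) :=
  - (phi \o rho x)%VF.

Fact precomp_opp_linear x : linear (precomp_opp x).
Proof.
move=> a phi psi; apply/lfunP => v.
by rewrite !(opp_lfunE, add_lfunE, scale_lfunE, comp_lfunE) opprD scalerN.
Qed.
HB.instance Definition _ x := GRing.isLinear.Build F 'Hom(V, F^o)
  'Hom(V, F^o) *:%R (precomp_opp x) (precomp_opp_linear x).

Definition dual_act (x : L) : 'End('Hom(V, F^o)) := linfun (precomp_opp x).

Lemma dual_actE x phi v : dual_act x phi v = - phi (rho x v).
Proof. by rewrite lfunE opp_lfunE comp_lfunE. Qed.

Fact dual_act_linear : linear dual_act.
Proof.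
move=> a x y; apply/lfunP => phi; apply/lfunP => v.
by rewrite !(add_lfunE, scale_lfunE) !dual_actE linearP !(add_lfunE, scale_lfunE)
  linearP opprD scalerN.
Qed.
HB.instance Definition _ := GRing.isLinear.Build F L 'End('Hom(V, F^o)) *:%R
  dual_act dual_act_linear.

Lemma dual_rep : is_rep rho -> is_rep dual_act.
Proof.
move=> rhoP x y phi; apply/lfunP => v; rewrite add_lfunE opp_lfunE !dual_actE.
by rewrite rhoP linearB !opprK opprB addrC.
Qed.

Lemma dual_neq0 : (fullv : {vspace V}) <> 0%VS ->
  (fullv : {vspace 'Hom(V, F^o)}) <> 0%VS.
Proof.
move=> V0 H0; have i : 'I_(\dim {:V}).
  have : (0 < \dim {:V})%N by rewrite lt0n dimv_eq0; apply/eqP.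
  by case: (\dim _) => // k _; apply: ord0.
have phiE : linfun (coord (vbasis {:V}) i : V -> F^o) = 0 :> 'Hom(V, F^o).
  by apply/eqP; rewrite -memv0 -H0 memvf.
have := coord_free i i (basis_free (vbasisP {:V})).
have := lfunE (coord (vbasis {:V}) i : {linear V -> F^o}) (vbasis {:V})`_i.
rewrite phiE zero_lfunE eqxx => <- /eqP.
by rewrite eq_sym oner_eq0.
Qed.

Lemma exists_dual_subrep :
    is_rep rho -> irreducible (anti_biaction rho) -> (exists x v, rho x v != 0) ->
  exists (W : vectType F) (sigma : {linear L -> 'End(W)}) (b : W -> V -> F^o),
    [/\ is_rep sigma, irreducible (anti_biaction sigma),
        exists x w, sigma x w != 0
      & [/\ (forall v, linear (b^~ v)) /\ (forall w, linear (b w)),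
            forall x w v, b (sigma x w) v + b w (rho x v) = 0
          & exists w v, b w v != 0]].
Proof.
move=> rhoP irr [x0 [v0 ntriv]]; have [V0 _] := irr.
have [U [sigma [sP irrs sE]]] :=
  exists_irreducible_subrep (dual_rep rhoP) (dual_neq0 V0).
have [U0 _] := irrs; exists (subvs_of U), sigma,
  (fun w v => (vsval w : 'Hom(V, F^o)) v).
have [w w0] : exists w : subvs_of U, w != 0.
  apply: contra_notP U0 => Uw; apply/eqP; rewrite -subv0; apply/subvP => w _.
  by rewrite memv0; apply: contraT => w0; case: Uw; exists w.
have w0' : vsval w != 0 by rewrite -(inj_eq val_inj) in w0.
split=> //.
  (* If [sigma] were trivial, the functional [w] would vanish on every [rho x m], hence on all of
     [V] by [act_image_full]. *)
  have [//|triv] := pselect (exists x w, sigma x w != 0).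
  case/eqP: w0'; apply/lfunP => v; rewrite zero_lfunE.
  suff kf : lker (vsval w) = fullv by apply/eqP; rewrite -memv_ker kf memvf.
  apply: (act_image_full irr).
  - by right; apply: anti_biactionP.
  - by move=> /(_ x0 v0)/= r0; rewrite r0 eqxx in ntriv.
  move=> x m; rewrite memv_ker /=; apply/eqP.
  have : vsval (sigma x w) m = 0.
    have -> : sigma x w = 0.
      by apply: contrapT => sw; apply: triv; exists x, w; apply/eqP.
    by rewrite zero_lfunE.
  by rewrite sE dual_actE => /eqP; rewrite oppr_eq0 => /eqP.
split.
- split=> [v|u] a u1 u2; last exact: linearP.
  by rewrite /= add_lfunE scale_lfunE.
- by move=> x u v; rewrite sE dual_actE addNr.
exists w; apply: contrapT => nw; case/eqP: w0'; apply/lfunP => v.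
by rewrite zero_lfunE; apply: contrapT => wv; apply: nw; exists v; apply/eqP.
Qed.

End Dual.
End Representations.

(** * The adjoint module *)

Section LinearCoordinates.
Variables (F : fieldType).

(** A spanning family of least length is free, so coordinates in it are unique and therefore
    linear. *)
Lemma finite_dimensional_coord (V : lmodType F) : finite_dimensional V ->
  exists n (f : {linear V -> 'rV[F]_n}), bijective f.
Proof.
move=> finV; pose P n := `[< exists e : 'I_n -> V,
  forall v, exists c : 'I_n -> F, v = \sum_i c i *: e i >].
have exP : exists n, P n by have [n e] := finV; exists n; apply/asboolP.
case: (ex_minnP exP) => n /asboolP[e eP] nmin.
have free (c : 'I_n -> F) : \sum_i c i *: e i = 0 -> forall k, c k = 0.
  move=> c0 k; apply/eqP; apply: contraT => ck.
  suff /nmin : P n.-1 by have := ltn_ord k; lia.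
  apply/asboolP; exists (e \o fintype.lift k) => v; have [d ->] := eP v.
  (* Subtracting a multiple of the relation [c] removes [e k] from the expansion of [v]. *)
  exists (fun j => d (fintype.lift k j) - d k / c k * c (fintype.lift k j)).
  have -> : \sum_i d i *: e i = \sum_i (d i - d k / c k * c i) *: e i.
    under [RHS]eq_bigr do rewrite scalerBl -scalerA.
    by rewrite sumrB -scaler_sumr c0 scaler0 subr0.
  by rewrite (bigD1_ord k) //= divfK // subrr scale0r add0r.
have [c cP] := choice eP; pose f v : 'rV[F]_n := \row_i c v i.
have fP (u : 'rV[F]_n) v : v = \sum_i u 0 i *: e i -> f v = u.
  move=> vE; apply/rowP => k; rewrite mxE; apply/eqP; rewrite -subr_eq0; apply/eqP.
  apply: (free (fun k => c v k - u 0 k)).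
  by under eq_bigr do rewrite scalerBl; rewrite sumrB -cP -vE subrr.
have f_lin : linear f.
  move=> a u v; apply: fP; rewrite {1}[u]cP {1}[v]cP scaler_sumr -big_split.
  by apply: eq_bigr => i _; rewrite !mxE scalerDl scalerA.
pose fL : {linear V -> 'rV[F]_n} :=
  HB.pack f (GRing.isLinear.Build F V 'rV[F]_n *:%R f f_lin).
exists n, fL.
exists (fun u : 'rV[F]_n => \sum_i u 0 i *: e i) => [v|u]; last exact: fP.
by rewrite [RHS]cP; apply: eq_bigr => i _; rewrite mxE.
Qed.

Lemma linear_section (V : lmodType F) n (f : {linear V -> 'rV[F]_n}) :
  (forall u, exists v, f v = u) -> exists s : {linear 'rV[F]_n -> V}, cancel s f.
Proof.
move=> f_surj; have [g gK] := choice (fun i => f_surj (delta_mx 0 i)).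
pose s (u : 'rV[F]_n) : V := \sum_i u 0 i *: g i.
have s_lin : linear s.
  move=> a u v; rewrite /s scaler_sumr -big_split.
  by apply: eq_bigr => i _; rewrite !mxE scalerDl scalerA.
pose sL : {linear 'rV[F]_n -> V} :=
  HB.pack s (GRing.isLinear.Build F 'rV[F]_n V *:%R s s_lin).
exists sL => u; rewrite /= /s.
rewrite linear_sum [RHS]row_sum_delta; apply: eq_bigr => i _.
by rewrite linearZ /= gK.
Qed.

End LinearCoordinates.

(** * The Leibniz kernel *)

Section LeibnizKernel.
Variables (F : fieldType) (L : leibnizAlgebra F).
Local Notation "x ** y" := (lbr L x y) (at level 40).

Lemma Leib_square x : @Leib F L (x ** x).
Proof. by move=> S [_ SA]; apply: SA; exists x. Qed.

Lemma lspan_min (V : lmodType F) (A S : set V) :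
  subspace S -> A `<=` S -> lspan A `<=` S.
Proof. by move=> Ssub AS v; apply; split. Qed.

(** When the first two entries of the Leibniz identity are both [z], it reduces to
    [(z ** z) ** y = 0]; linearity extends this to the span of the squares. *)
Lemma Leib_mull x y : @Leib F L x -> x ** y = 0.
Proof.
apply: (lspan_min (S := [set x | x ** y = 0])).
  split=> [|a u v /= u0 v0]; first by rewrite /= linear0l.
  by rewrite linearPl u0 v0 scaler0 addr0.
move=> _ [z _ <-] /=.
by have /eqP := lbr_leibniz z z y; rewrite -subr_eq subrr => /eqP.
Qed.

(** Polarisation of the square of [x + y]. *)
Lemma Leib_add x y : @Leib F L (x ** y + y ** x).
Proof.
have [S0 SD] := @lspan_subspace F L (@squares F L).
have -> : x ** y + y ** x =
    (-1) *: (x ** x) + ((-1) *: (y ** y) + (x + y) ** (x + y)).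
  rewrite linearDl !linearDr /= !scaleN1r [- (y ** y) + _]addrC.
  by rewrite [_ + (y ** x + _)]addrA addrK -addrA addKr.
by apply: (SD); [|apply: (SD)]; apply: Leib_square.
Qed.

Lemma Leib_mulr x y : @Leib F L y -> @Leib F L (x ** y).
Proof.
by move=> yL; have := Leib_add x y; rewrite (Leib_mull x yL) addr0.
Qed.

End LeibnizKernel.

(** * The adjoint representation on the canonical Lie algebra *)

Section Adjoint.
Variables (F : fieldType) (L : leibnizAlgebra F) (n : nat).
Variables (p : {linear L -> 'rV[F]_n}) (s : {linear 'rV[F]_n -> L}).
Hypothesis pK : cancel s p.
Hypothesis ker_p : forall x, p x = 0 <-> @Leib F L x.
Local Notation "x ** y" := (lbr L x y) (at level 40).

(** As [p] has kernel [Leib], row vectors model the canonical Lie algebra; [adjoint_proj] shows that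
    the choice of [s] does not matter. *)
Definition adjoint (x : L) : 'End('rV[F]_n) := linfun (p \o lbr L x \o s).

Lemma adjointE x u : adjoint x u = p (x ** s u).
Proof. by rewrite lfunE. Qed.

Fact adjoint_linear : linear adjoint.
Proof.
move=> a x y; apply/lfunP => u.
by rewrite add_lfunE scale_lfunE !adjointE linearPl linearP.
Qed.
HB.instance Definition _ := GRing.isLinear.Build F L 'End('rV[F]_n) *:%R
  adjoint adjoint_linear.

Lemma proj_eq x y : @Leib F L (x - y) -> p x = p y.
Proof. by move=> /ker_p; rewrite linearB => /eqP; rewrite subr_eq0 => /eqP. Qed.

Lemma proj_section x : @Leib F L (s (p x) - x).
Proof. by apply/ker_p; rewrite linearB /= pK subrr. Qed.

Lemma adjoint_proj x y : adjoint x (p y) = p (x ** y).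
Proof.
rewrite adjointE; apply: proj_eq; rewrite -linearBr; apply: Leib_mulr.
exact: proj_section.
Qed.

Lemma adjoint_eq x y : p x = p y -> adjoint x = adjoint y.
Proof.
move=> pxy; apply/lfunP => u; rewrite !adjointE; congr (p _).
apply/eqP; rewrite -subr_eq0 -linearBl /=; apply/eqP/Leib_mull/ker_p.
by rewrite linearB pxy subrr.
Qed.

Lemma adjoint_rep : is_rep adjoint.
Proof.
move=> x y u; rewrite -[u]pK !adjoint_proj -linearB /=; congr (p _).
by rewrite lbr_leibniz addrK.
Qed.

(** An irreducible subspace [U] of the adjoint module is a minimal ideal of the canonical Lie
    algebra, and [b] is its bracket. If [b] were zero, the preimage of [U] would be a solvable
    ideal, hence inside [Leib], and [U] would be zero. *)
Lemma exists_irreducible_bracket : (exists x : L, x != 0) -> semisimple L ->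
  exists (V : vectType F) (rho : {linear L -> 'End(V)}) (b : V -> V -> V),
    [/\ is_rep rho, irreducible (anti_biaction rho),
        exists x v, rho x v != 0
      & [/\ (forall w, linear (b^~ w)) /\ (forall v, linear (b v)),
            forall x v w, rho x (b v w) = b (rho x v) w + b v (rho x w)
          & exists v w, b v w != 0]].
Proof.
move=> [x0 x00] ssL; have V0 : (fullv : {vspace 'rV[F]_n}) <> 0%VS.
  (* If the quotient were zero, all of [L] would lie in [Leib] and so have zero left
     multiplications; then squares vanish, and [Leib], which is all of [L], is zero. *)
  move=> V0; have LLeib x : @Leib F L x.
    by apply/ker_p/eqP; rewrite -memv0 -V0 memvf.
  case/eqP: x00; apply: (lspan_min (S := [set 0]) _ _ (LLeib x0)).
    by split=> // a u v -> ->; rewrite scaler0 addr0.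
  by move=> _ [x _ <-]; apply: Leib_mull.
have [U [rho [rhoP irr rhoE]]] := exists_irreducible_subrep adjoint_rep V0.
pose b (v w : subvs_of U) := rho (s (vsval v)) w.
have rho_eq x y : p x = p y -> rho x = rho y.
  move=> pxy; apply/lfunP => v; apply: val_inj.
  by rewrite /= !rhoE /= (adjoint_eq pxy).
have [v [w bvw]] : exists v w, b v w != 0.
  apply: contrapT => b0; case: irr => U0 _; apply: U0.
  have pU x y : p x \in U -> p y \in U -> p (x ** y) = 0.
    move=> pxU pyU; rewrite -adjoint_proj -(vsprojK pyU) -rhoE.
    have -> : rho x (vsproj U (p y)) = b (vsproj U (p x)) (vsproj U (p y)).
      rewrite /b; congr (fun_of_lfun _ _); apply: rho_eq.
      by rewrite vsprojK // pK.
    have [->|nz] := eqVneq (b (vsproj U (p x)) (vsproj U (p y))) 0.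
      by rewrite linear0.
    by case: b0; exists (vsproj U (p x)), (vsproj U (p y)).
  pose I : set L := [set x | p x \in U].
  have I_ideal : leibniz_ideal I.
    split=> [|x y yI]; first split=> [|a u v uI vI]; rewrite /I /=.
    - by rewrite linear0 mem0v.
    - by rewrite linearP rpredD ?rpredZ.
    have xyI : p (x ** y) \in U.
      by rewrite -adjoint_proj -(vsprojK yI) -rhoE subvsP.
    split=> //; have /ker_p/eqP := Leib_add y x.
    by rewrite linearD addr_eq0 => /eqP->; rewrite rpredN.
  have I_solvable : solvable_ideal I.
    (* The first derived term lies in [Leib], whose left multiplications vanish, so the second is
       zero. *)
    exists 2%N; apply/seteqP; split; last first.
      by move=> _ ->; have [] := @lspan_subspace F L
           [set x ** y | x in derived_series I 1 & y in derived_series I 1].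
    apply: lspan_min.
      by split=> // a u v -> ->; rewrite scaler0 addr0.
    move=> _ [x xI [y _ <-]]; apply: Leib_mull.
    apply: lspan_min xI; first exact: lspan_subspace.
    by move=> _ [z zI [t tI <-]]; apply/ker_p/pU.
  apply/eqP; rewrite -subv0; apply/subvP => u _; rewrite memv0; apply/eqP/val_inj.
  have /ker_p : @Leib F L (s (vsval u)).
    by apply: (ssL I I_ideal I_solvable); rewrite /I /= pK subvsP.
  by rewrite pK.
exists (subvs_of U), rho, b; split=> //; first by exists (s (vsval v)), w.
split; last by exists v, w.
- split=> [t|u] a u1 u2; last exact: linearP.
  by rewrite /b !linearP /= add_lfunE scale_lfunE.
- move=> x u t; rewrite /b.
  (* Both arguments of [rho] have the same image under [p], so [rhoP] yields equivariance of the
     bracket. *)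
  have -> : rho (s (vsval (rho x u))) = rho (x ** s (vsval u)).
    by apply: rho_eq; rewrite pK rhoE adjointE.
  by rewrite rhoP subrK.
Qed.

End Adjoint.

(** * Symmetric and antisymmetric classes *)

Section IrreducibleClasses.
Variables (F : fieldType) (L : leibnizAlgebra F).
Implicit Types V W : vectType F.

Lemma canonical_Lie_coord : finite_dimensional (canonical_Lie L) ->
  exists n (p : {linear L -> 'rV[F]_n}) (s : {linear 'rV[F]_n -> L}),
    cancel s p /\ forall x, p x = 0 <-> @Leib F L x.
Proof.
move=> /finite_dimensional_coord[n [f [g fK gK]]].
pose q := lquot (@squares F L); pose p x := f (\pi_q x).
have p_lin : linear p.
  by move=> a x y; rewrite /p pi_lquotD pi_lquotZ; apply: (linearP f).
pose pL : {linear L -> 'rV[F]_n} :=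
  HB.pack p (GRing.isLinear.Build F L 'rV[F]_n *:%R p p_lin).
have [|s sK] := @linear_section _ _ _ pL.
  move=> u; have [x xE] := lquot_surj (g u); exists x.
  by rewrite -[u]gK xE.
exists n, pL, s; split=> // x.
have -> : pL x = 0 <-> \pi_q x = \pi_q 0.
  have -> : \pi_q 0 = 0 by rewrite !piE.
  by split=> [/(congr1 g)|px]; [rewrite fK -(linear0 f) fK|rewrite /= /p px linear0].
split=> [/eqP|xL]; first by rewrite piE /Quotient.equiv subr0 => /asboolP.
by apply: pi_lquot_eq; rewrite subr0; apply/asboolP.
Qed.

Lemma linear_fun0 (V W : lmodType F) (f : V -> W) : linear f -> f 0 = 0.
Proof. by move=> fP; have := fP (-1) 0 0; rewrite scaler0 addr0 scaleN1r addNr. Qed.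

Lemma linear_funN (V W : lmodType F) (f : V -> W) u : linear f -> f (- u) = - f u.
Proof.
by move=> fP; have := fP (-1) u 0; rewrite (linear_fun0 fP) !addr0 !scaleN1r.
Qed.

Lemma symmetric_iso V W (X : biaction L V) (Y : biaction L W) :
  isomorphic X Y -> symmetric_act Y -> symmetric_act X.
Proof.
move=> [f [f_bij fE]] sY x m; apply: (bij_inj f_bij).
by rewrite linearN /= (fE _ _).1 (fE _ _).2.
Qed.

Lemma antisymmetric_iso V W (X : biaction L V) (Y : biaction L W) :
  isomorphic X Y -> antisymmetric_act Y -> antisymmetric_act X.
Proof.
move=> [f [f_bij fE]] sY x m; apply: (bij_inj f_bij).
by rewrite linear0 (fE _ _).2.
Qed.

Lemma trivial_iso V W (X : biaction L V) (Y : biaction L W) :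
  isomorphic X Y -> trivial_act X -> trivial_act Y.
Proof.
move=> [f [[g fK gK] fE]] tX x m.
by rewrite -[m]gK -(fE _ _).1 tX linear0.
Qed.

Lemma trivial_irreducible :
  irreducible (anti_biaction (\0 : {linear L -> 'End(F^o)})).
Proof.
split=> [F0|U _].
  by have := memvf (1 : F^o); rewrite F0 memv0 oner_eq0.
have [->|U0] := eqVneq U 0%VS; [by left|right].
apply/eqP; rewrite eqEsubv subvf; apply/subvP => a _.
have u0 : vpick U != 0 by rewrite vpick0.
have -> : a = (a / vpick U : F) *: vpick U by rewrite /GRing.scale /= divfK.
by rewrite rpredZ ?memv_pick.
Qed.

Lemma pairing_multiplicity_gt0 (a c b : Irr L) V W T (M : biaction L V)
    (N : biaction L W) (Y : biaction L T) f :
    isomorphic (irr_repr a) M -> isomorphic (irr_repr c) N ->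
    isomorphic (irr_repr b) Y ->
    equivariant_pairing M N Y f -> (exists v w, f v w != 0) ->
  (0 < multiplicity (trunc_tensor (irr_repr a) (irr_repr c)) (irr_repr b))%N.
Proof.
move=> aM cN bY MNY f0.
have [f' f'P f'0] := equivariant_pairing_iso aM cN (isomorphic_sym bY) MNY f0.
exact: trunc_multiplicity_gt0 f'P (irr_irreducible _) f'0.
Qed.

Definition symmetric_class (a : Irr L) := symmetric_act (irr_repr a).
Definition antisymmetric_class (a : Irr L) := antisymmetric_act (irr_repr a).
Definition nontrivial_class (a : Irr L) := ~ trivial_act (irr_repr a).

Lemma trunc_multiplicity_eq0 (a c b : Irr L) :
    symmetric_class a /\ antisymmetric_class c \/
    antisymmetric_class a /\ symmetric_class c ->
    nontrivial_class a -> nontrivial_class c ->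
  multiplicity (trunc_tensor (irr_repr a) (irr_repr c)) (irr_repr b) = 0%N.
Proof.
move=> ac nta ntc; apply: multiplicity0; first exact: irr_irreducible.
by apply: trunc_eq0 => //; apply: irr_irreducible.
Qed.

Lemma gr_mul_eq0 (a c : Irr L) :
    symmetric_class a /\ antisymmetric_class c \/
    antisymmetric_class a /\ symmetric_class c ->
    nontrivial_class a -> nontrivial_class c ->
  gr_mul << a >> << c >> = 0 :> Gr L.
Proof.
move=> ac nta ntc; apply: gr_supported_eq0.
apply: (@gr_supported_mul _ _ (eq a) (eq c)); try exact: gr_supported1.
by move=> _ _ b <- <-; rewrite trunc_multiplicity_eq0.
Qed.

Lemma gr_supported_symmetric (u v : Gr L) :
  gr_supported symmetric_class u -> gr_supported symmetric_class v ->
  gr_supported symmetric_class (gr_mul u v).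
Proof.
apply: gr_supported_mul => a c b sa sc; apply: symmetric_multiplicity.
exact: trunc_symmetric.
Qed.

Lemma gr_supported_antisymmetric (u v : Gr L) :
  gr_supported antisymmetric_class u -> gr_supported antisymmetric_class v ->
  gr_supported antisymmetric_class (gr_mul u v).
Proof.
apply: gr_supported_mul => a c b sa sc; apply: antisymmetric_multiplicity.
exact: trunc_antisymmetric.
Qed.

(** An antisymmetric class with non-trivial left action gives product zero; one with trivial left
    action is symmetric too, and symmetric classes multiply to symmetric ones. *)
Lemma gr_supported_antisymmetric_symmetric (u v : Gr L) :
    gr_supported antisymmetric_class u ->
    gr_supported (fun c => symmetric_class c /\ nontrivial_class c) v ->
  gr_supported symmetric_class (gr_mul u v).
Proof.
apply: gr_supported_mul => a c b Aa [Sc ntc].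
have [ta|nta] := pselect (trivial_act (irr_repr a)); last first.
  by rewrite trunc_multiplicity_eq0 //; right.
apply/symmetric_multiplicity/trunc_symmetric => // x m.
by rewrite Aa ta oppr0.
Qed.

Lemma symmetric_antisymmetric_trivial (a : Irr L) :
  symmetric_class a -> antisymmetric_class a -> trivial_act (irr_repr a).
Proof. by move=> Sa Aa x m; apply: oppr_inj; rewrite -Sa Aa oppr0. Qed.

(* [p], [q], [r] and [e] are the classes of V_s, V_a, V'_s and of the trivial
   bimodule. *)
Lemma exists_irr_classes : (exists x : L, x != 0) -> semisimple L ->
    finite_dimensional (canonical_Lie L) ->
  exists p q r e : Irr L,
    [/\ [/\ symmetric_class p, antisymmetric_class q & symmetric_class r],
        [/\ nontrivial_class p, nontrivial_class q & nontrivial_class r]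
      & let mult a c b :=
          multiplicity (trunc_tensor (irr_repr a) (irr_repr c)) (irr_repr b) in
        [/\ (0 < mult r p e)%N, (0 < mult q q q)%N,
            (0 < mult e q q)%N & (0 < mult q e q)%N]].
Proof.
move=> Lnz ssL /canonical_Lie_coord[n [pr [s [prK ker_pr]]]].
have [V [rho [b [rhoP irr nt [[bl br] bE b0]]]]] :=
  exists_irreducible_bracket prK ker_pr Lnz ssL.
have [W [sigma [d [sigmaP irrs nts [[dl dr] dE d0]]]]] :=
  exists_dual_subrep rhoP irr nt.
have zeroP : is_rep (\0 : {linear L -> 'End(F^o)}).
  by move=> x y v; rewrite /= !zero_lfunE subrr.
have [p pE] := irr_class_exists (sym_bimodule rhoP) (sym_irreducible irr).
have [q qE] := irr_class_exists (anti_bimodule rhoP) irr.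
have [r rE] := irr_class_exists (sym_bimodule sigmaP) (sym_irreducible irrs).
have [e eE] := irr_class_exists (anti_bimodule zeroP) trivial_irreducible.
exists p, q, r, e; split; first split.
- exact: symmetric_iso pE (sym_biactionP rho).
- exact: antisymmetric_iso qE (anti_biactionP rho).
- exact: symmetric_iso rE (sym_biactionP sigma).
- have [x [v rv]] := nt; have [y [w sw]] := nts.
  split=> [/(trivial_iso pE)/(_ x v)|/(trivial_iso qE)/(_ x v)
    |/(trivial_iso rE)/(_ y w)] /= z0.
  + by rewrite z0 eqxx in rv.
  + by rewrite z0 eqxx in rv.
  + by rewrite z0 eqxx in sw.
have [v1 v10] : exists v : V, v != 0.
  by have [v [w]] := b0; exists (b v w).
(* Scalar multiplication pairs [F^o] with [V]; it gives the two multiplicities that involve [e] as a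
   factor. *)
have scl : (forall w : V, linear (fun a : F^o => (a : F) *: w)) /\
    (forall a : F^o, linear (fun w : V => (a : F) *: w)).
  split=> [w a c c'|a c u v]; first by rewrite scalerDl scalerA.
  by rewrite scalerDr !scalerA mulrC.
have d0l w : d 0 w = 0 by exact: linear_fun0 (dl w).
have d0r w : d w 0 = 0 by exact: linear_fun0 (dr w).
have dNl u w : d (- u) w = - d u w by exact: linear_funN (dl w).
have dNr u w : d w (- u) = - d w u by exact: linear_funN (dr w).
have b0l w : b 0 w = 0 by exact: linear_fun0 (bl w).
have b0r w : b w 0 = 0 by exact: linear_fun0 (br w).
split.
(* Evaluation is invariant, and in symmetric modules the sums of left and right action in the
   generators vanish. *)
- apply: (pairing_multiplicity_gt0 rE pE eE) d0; split=> // [x w v|x w v|x y w v].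
  + by rewrite /= zero_lfunE dE.
  + by rewrite !sym_biactionP anti_biactionP dNl dNr -opprD dE oppr0.
  + by rewrite !sym_biactionP !subrr d0l d0r addr0.
(* The bracket of [V]: all right actions are zero, so only the left condition has content. *)
- apply: (pairing_multiplicity_gt0 qE qE qE) b0; split=> // [x v w|x y v w].
  + by rewrite !anti_biactionP b0l b0r addr0.
  + by rewrite !anti_biactionP b0l b0r addr0.
- apply: (pairing_multiplicity_gt0 eE qE qE
    (f := fun (a : F^o) (w : V) => (a : F) *: w)).
    split=> // [x a w|x a w|x y a w].
    + by rewrite /= zero_lfunE linearZ scale0r add0r.
    + by rewrite !anti_biactionP scale0r scaler0 addr0.
    + by rewrite !anti_biactionP scaler0 scale0r addr0.
  by exists 1, v1; rewrite scale1r.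
- apply: (pairing_multiplicity_gt0 qE eE qE
    (f := fun (w : V) (a : F^o) => (a : F) *: w)).
    split=> // [|x w a|x w a|x y w a].
    + by have [] := scl.
    + by rewrite /= zero_lfunE linearZ scale0r addr0.
    + by rewrite !anti_biactionP scale0r scaler0 addr0.
    + by rewrite !anti_biactionP !addr0 scale0r scaler0 addr0.
  by exists v1, 1; rewrite scale1r.
Qed.

End IrreducibleClasses.

(** * Failure of the alternative and Jordan identities *)

Theorem theorem5p18 (F : fieldType) (L : leibnizAlgebra F)
    (charF : [pchar F] =i pred0)
    (L_nonzero : exists x : L, x != 0)
    (L_semisimple : semisimple L)
    (L_Lie_fin : finite_dimensional (canonical_Lie L)) :
  ~ alternative (@gr_mul F L) /\ ~ jordan (@gr_mul F L).
Proof.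
have [p [q [r [e [[Sp Aq Sr] [ntp ntq ntr] /= [mrp mqq meq mqe]]]]]] :=
  exists_irr_classes L_nonzero L_semisimple L_Lie_fin.
have pq : gr_mul << p >> << q >> = 0 :> Gr L by apply: gr_mul_eq0 => //; left.
have rq : gr_mul << r >> << q >> = 0 :> Gr L by apply: gr_mul_eq0 => //; left.
have qp : gr_mul << q >> << p >> = 0 :> Gr L by apply: gr_mul_eq0 => //; right.
have nn1 (a : Irr L) : gr_nonneg << a >> := gr_nonneg1 a.
have nn2 (a c : Irr L) : gr_nonneg (gr_mul << a >> << c >>).
  exact: gr_nonneg_mul.
have c1 (a : Irr L) : 0 < coeff a (<< a >> : Gr L) by rewrite coeffU eqxx mulr1.
have erp : 0 < coeff e (gr_mul << r >> << p >>) by apply: gr_mul_gt0 mrp.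
have qqq : 0 < coeff q (gr_mul << q >> << q >>) by apply: gr_mul_gt0 mqq.
split=> [/(_ (<< p >> + << r >>) << q >>)[alt _]|/(_ (<< p >> - << q >>) << r >>)].
  have : 0 < coeff q
      (gr_mul (gr_mul (<< p >> + << r >>) (<< p >> + << r >>)) << q >>).
    apply: (gr_mul_gt0 _ _ _ (c1 q) meq) => //.
      by apply: gr_nonneg_mul; apply: gr_nonnegD.
    (* Among the four products in the square, [r p] has a positive coefficient at [e] and the others
       are non-negative. *)
    rewrite gr_mulDl !gr_mulDr !coeffD.
    apply: ltr_wpDl; first by rewrite addr_ge0 ?nn2.
    by apply: ltr_wpDr => //; apply: nn2.
  by rewrite alt [gr_mul _ << q >>]gr_mulDl pq rq addr0 gr_mul0r coeff0 ltxx.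
set z := gr_mul (_ - _) (_ - _) => jor.
(* The cross terms [p q] and [q p] vanish. *)
have zE : z = gr_mul << p >> << p >> + gr_mul << q >> << q >>.
  by rewrite /z gr_mulBl !gr_mulBr pq qp subr0 sub0r opprK.
have z0 : gr_nonneg z by rewrite zE; apply: gr_nonnegD.
have zr0 : gr_nonneg (gr_mul z << r >>) by apply: gr_nonneg_mul.
have sup1 (P : Irr L -> Prop) a : P a -> gr_supported P << a >>.
  exact: gr_supported1.
have zrS : gr_supported (@symmetric_class F L) (gr_mul z << r >>).
  rewrite zE gr_mulDl; apply: gr_supportedD.
    by apply: gr_supported_symmetric; [apply: gr_supported_symmetric|]; apply: sup1.
  apply: gr_supported_antisymmetric_symmetric; last exact: sup1.
  by apply: gr_supported_antisymmetric; apply: sup1.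
(* A product of symmetric classes cannot contain [q]: being both symmetric and antisymmetric, [q]
   would be trivial. *)
have zrp : coeff q (gr_mul (gr_mul z << r >>) << p >>) = 0.
  apply/eqP; apply: contraT => /(gr_supported_symmetric zrS (sup1 _ _ Sp)) Sq.
  by case: ntq; apply: symmetric_antisymmetric_trivial.
(* [q] occurs in [z] through the square of [q], [e] occurs in [r p], and [q e] contains [q]. *)
have : 0 < coeff q (gr_mul z (gr_mul << r >> << p >>)).
  apply: (gr_mul_gt0 _ _ _ erp mqe) => //.
  by rewrite zE coeffD ltr_wpDl ?nn2.
have -> : gr_mul << r >> << p >> = gr_mul << r >> (<< p >> - << q >>).
  by rewrite gr_mulBr rq subr0.
(* By the Jordan identity the positive coefficient equals minus the coefficient of [q] in [(z r) q],
   which is at most zero. *)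
rewrite -jor gr_mulBr coeffB zrp sub0r oppr_gt0 ltNge.
by rewrite (gr_nonneg_mul zr0).
Qed.
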